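(* In the deconvolution setting of the context, suppose that the source condition $(\varphi,T)\in\mathcal F(0,\beta,C)$ (with $t=0$) holds. Then $$\|\hat\varphi_{\alpha_n}-\varphi\|_\infty\le\|\nu_{2,n}\|_\infty+R\alpha_n^{\beta\wedge1},\qquad \nu_{2,n}=(\alpha_nI+T^*T)^{-1}\left(\widehat{T^*r}-T^*r\right)=\frac1n\sum_{i=1}^n(\alpha_nI+T^*T)^{-1}X_{2,i},$$ with $X_{2,i}(z)=f(Y_i-z)-\mathbb E f(Y-z)$ and $R=C^2\left[\beta^\beta(1-\beta)^{1-\beta}\mathbf 1_{0<\beta<1}+C^{2(\beta-1)}\mathbf 1_{\beta\ge1}\right]$. If in addition Assumption D holds, then $$\sup_{(\varphi,T)\in\mathcal F}\mathbb E\|\hat\varphi_{\alpha_n}-\varphi\|_\infty=O\left(\frac{1}{\alpha_n^{3/2}n^{1/2}}+\alpha_n^{\beta\wedge1}\right).$$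
   Context: Deconvolution model: $Y=Z+U$ with $Z,U$ independent real random variables; $Z$ has density $\varphi$, $U$ has known density $f$, and $Y$ has density $r$. On $L_2[a,b]$, $(T\varphi)(y)=\int\varphi(z)f(y-z)dz$ and $(T^*\psi)(z)=\int\psi(y)f(y-z)dy$, so $r=T\varphi$ and $(T^*r)(z)=\mathbb E f(Y-z)$. From an i.i.d. sample $(Y_i)_{i=1}^n$: $\widehat{T^*r}(z)=\frac1n\sum_if(Y_i-z)$ and $\hat\varphi_{\alpha_n}=(\alpha_nI+T^*T)^{-1}\widehat{T^*r}$ with $\alpha_n>0$, $\alpha_n\to0$. $\|\cdot\|$: $L_2$ norm; $\|\cdot\|_\infty$: sup norm; $\|A\|_{2,\infty}=\sup_{\|\psi\|\le1}\|A\psi\|_\infty$. Source class $\mathcal F(0,\beta,C)$ ($\beta,C,M>0$): pairs $(\varphi,T)$ with $\varphi$ continuous on $[a,b]$, $\|\varphi\|_\infty\le M$, $T^*$ bounded from $L_2[a,b]$ into continuous functions, $\varphi=(T^*T)^\beta T^*\psi$ for some $\psi\in L_2[a,b]$, and $\|T^*\|_{2,\infty}\vee\|\psi\|\vee\|T\|^{-1}\le C$. Assumption D: (i) $(Y_i)_{i=1}^n$ is an i.i.d. sample of $Y$; (ii) $f,\varphi,r$ are continuous and compactly supported in subsets of $[a,b]$, $a<b<\infty$; (iii) $f\in C^s_M[a,b]$ for some $s\in(0,1]$, i.e. $\|f\|_\infty\le M$ and $|f(x)-f(x')|\le M|x-x'|^s$; (iv) $T:L_2[a,b]\to L_2[a,b]$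 is one-to-one. *)

(* Defs.v *)
From HB Require Import structures.
From mathcomp Require Import all_boot all_order all_algebra.
From mathcomp Require Import all_classical all_reals all_analysis.
Set Implicit Arguments. Unset Strict Implicit. Unset Printing Implicit Defensive.
Import Order.TTheory GRing.Theory Num.Theory.
Import numFieldNormedType.Exports.
Local Open Scope classical_set_scope.
Local Open Scope ring_scope.

Section Deconv.
Variable R : realType.
Notation leb := (@lebesgue_measure R).

Definition Iab (a b : R) : set R := `[a, b]%classic.

Definition L2 (a b : R) (g : R -> R) : Prop :=
  measurable_fun (Iab a b) g /\
  (\int[leb]_(x in Iab a b) ((g x) ^+ 2)%:E < +oo)%E.

Definition inner (a b : R) (g h : R -> R) : R :=
  Rintegral leb (Iab a b) (fun x => g x * h x).
Definition L2norm (a b : R) (g : R -> R) : R :=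
  Num.sqrt (Rintegral leb (Iab a b) (fun x => (g x) ^+ 2)).

Definition supnorm (a b : R) (g : R -> R) : \bar R :=
  ereal_sup [set (`|g x|)%:E | x in Iab a b].

Definition Top (a b : R) (f g : R -> R) : R -> R :=
  fun y => Rintegral leb (Iab a b) (fun z => g z * f (y - z)).
Definition Tstar (a b : R) (f g : R -> R) : R -> R :=
  fun z => Rintegral leb (Iab a b) (fun y => g y * f (y - z)).
Definition TstarT (a b : R) (f g : R -> R) : R -> R :=
  Tstar a b f (Top a b f g).

Definition opnormT (a b : R) (f : R -> R) : \bar R :=
  ereal_sup [set (L2norm a b (Top a b f g))%:E
            | g in [set g | L2 a b g /\ L2norm a b g <= 1]].
Definition opnormTstar2inf (a b : R) (f : R -> R) : \bar R :=
  ereal_sup [set supnorm a b (Tstar a b f g)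
            | g in [set g | L2 a b g /\ L2norm a b g <= 1]].

Definition L2lim (a b : R) (u : nat -> R -> R) (v : R -> R) : Prop :=
  (fun N => L2norm a b (fun x => u N x - v x)) @ \oo --> (0 : R).

Definition spectral_decomp (a b : R) (K : (R -> R) -> (R -> R))
    (e : nat -> R -> R) (lam : nat -> R) : Prop :=
  [/\ (forall k, L2 a b (e k)),
      (forall i j, inner a b (e i) (e j) = (i == j)%:R),
      (forall k, 0 <= lam k) &
      (forall g, L2 a b g ->
         L2lim a b (fun N x => \sum_(k < N) lam k * inner a b g (e k) * e k x) (K g))].

(* u = K^beta h  (functional calculus through a spectral decomposition of K) *)
Definition is_fpow (a b : R) (K : (R -> R) -> (R -> R)) (beta : R) (h u : R -> R)
  : Prop :=
  exists e lam, spectral_decomp a b K e lam /\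
    L2lim a b (fun N x => \sum_(k < N) (lam k `^ beta) * inner a b h (e k) * e k x) u.

Definition is_resolvent (a b : R) (f : R -> R) (alpha : R) (g h : R -> R) : Prop :=
  L2 a b h /\ forall z, Iab a b z -> alpha * h z + TstarT a b f h z = g z.

Definition is_density (g : R -> R) : Prop :=
  measurable_fun setT g /\ (forall x, 0 <= g x) /\
  (\int[leb]_x (g x)%:E = 1)%E.

Definition classF (a b beta C M : R) (phi f : R -> R) : Prop :=
  [/\ {within Iab a b, continuous phi} /\ (supnorm a b phi <= M%:E)%E,
      (forall g, L2 a b g -> {within Iab a b, continuous (Tstar a b f g)}),
      (opnormTstar2inf a b f <= C%:E)%E,
      (1 <= C%:E * opnormT a b f)%E &
      exists psi, [/\ L2 a b psi, L2norm a b psi <= C &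
        is_fpow a b (TstarT a b f) beta (Tstar a b f psi) phi]].

Definition supported_in (a b : R) (g : R -> R) : Prop :=
  forall x, ~ Iab a b x -> g x = 0.
Definition assumptionD (a b s M : R) (phi f : R -> R) : Prop :=
  [/\ a < b, 0 < s <= 1,
      [/\ continuous f, continuous phi & continuous (Top a b f phi)] /\
      [/\ supported_in a b f, supported_in a b phi & supported_in a b (Top a b f phi)],
      (forall x, `|f x| <= M) /\ (forall x x', `|f x - f x'| <= M * `|x - x'| `^ s) &
      (forall g, L2 a b g -> L2norm a b (Top a b f g) = 0 -> L2norm a b g = 0)].

Definition iid_sample (d : measure_display) (Omega : measurableType d)
    (P : probability Omega R) (Y : nat -> Omega -> R) (r : R -> R) : Prop :=
  [/\ (forall i, measurable_fun setT (Y i)),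
      (forall (n : nat) (B : nat -> set R), (forall i, measurable (B i)) ->
         P (\bigcap_(i in `I_n) (Y i @^-1` B i)) =
           (\prod_(i < n) P (Y i @^-1` B i))%E) &
      (forall i (B : set R), measurable B ->
         P (Y i @^-1` B) = (\int[leb]_(y in B) (r y)%:E)%E)].

Definition hatTstar_r (f : R -> R) (n : nat) (y : nat -> R) : R -> R :=
  fun z => n%:R^-1 * \sum_(i < n) f (y i - z).
Definition X2 (a b : R) (f phi : R -> R) (yi : R) : R -> R :=
  fun z => f (yi - z) - Tstar a b f (Top a b f phi) z.

Definition Rconst (beta C : R) : R :=
  C ^+ 2 * ((if (0 < beta) && (beta < 1) then beta `^ beta * (1 - beta) `^ (1 - beta)
             else 0)
            + (if 1 <= beta then C `^ (2 * (beta - 1)) else 0)).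

End Deconv.

(* Main.v *)
Require Import Defs.
From HB Require Import structures.
From mathcomp Require Import all_boot all_order all_algebra.
From mathcomp Require Import all_classical all_reals all_analysis measurable_realfun.
From mathcomp Require Import ring lra.
Set Implicit Arguments. Unset Strict Implicit. Unset Printing Implicit Defensive.
Import Order.TTheory GRing.Theory Num.Theory.
Import numFieldNormedType.Exports.
Local Open Scope classical_set_scope.
Local Open Scope ring_scope.

(* The deterministic part needs no summation of the spectral series of T^*T.
   The error v solves (alpha + T^*T) v = xi - alpha phi.  Truncating the
   expansion phi = sum_k lam_k^beta <psi, T e_k> e_k at N terms gives a solution
   v_N of the equation with right-hand side -alpha phi_N which has the form
   T^* g_N; Bessel's inequality for the system T e_k / sqrt(lam_k) bounds the
   norm of g_N, hence the sup norm of v_N.  The energy identity bounds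
   T (v - v_N) in L2 and so T^*T (v - v_N) uniformly, and what remains is
   phi - phi_N, which tends to 0 in L2 and disappears because v is continuous.
   Young's inequality for the density f gives ||T|| <= 1, whence lam_k <= 1 <= C.

   For the rate, xi is the empirical process z |-> P_n f(. - z) - P f(. - z),
   and dyadic chaining with exponential moments gives E sup |xi| = O(n^(-1/2))
   for every Holder exponent s. *)

(** Two obstacles shape the proof. The spectral series converges only in L2, so the eigenrelation
    for [e k] holds only up to a null function. Pointwise identities are recovered by applying K =
    T^*T, which sends null functions to 0 at every point; the truncations are therefore built from K
    e_k instead of lam_k e_k. Moreover [Rintegral] of a divergent integral is 0, so linearity of T
    and T^* and their adjointness are available only once the kernel sections f(. - z) and f(y - .)
    are known to be square integrable. In the deterministic part f is not assumed bounded, and this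
    has to be extracted from the bound C on the norm of T^* from L2 to sup. The exponent 3/2 has two
    sources. The energy identity controls T v rather than v, at the price alpha^(-1/2); reading v
    off its own equation costs a further alpha^(-1). Both parts use the same estimate: xi = 0 for
    the error of phihat - nu, and xi the empirical error for the rate. *)

(** * Translation and reflection invariance of Lebesgue integrals *)

Section LebesgueInvariance.
Variable R : realType.
Local Notation leb := (@lebesgue_measure R).
Local Open Scope ereal_scope.

Lemma lebesgue_measure_shift (c : R) (A : set R) : measurable A ->
  pushforward leb (fun x : measurableTypeR R => (x + c)%R : measurableTypeR R) A = leb A.
Proof.
have mshift : measurable_fun setT (fun x : measurableTypeR R => (x + c)%R : measurableTypeR R).
  exact: measurable_funD.
pose S := isMeasurableFun.Build _ _ _ _ _ mshift.
pose phi : {mfun _ >-> _} := HB.pack (fun x : measurableTypeR R => (x + c)%R : measurableTypeR R) S.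
move=> mA; apply/esym.
apply: (@lebesgue_measure_unique _ (pushforward leb phi)) => //= _ [[a b]] _ <-.
rewrite /pushforward /=.
have -> : (fun x : R => (x + c)%R) @^-1` `]a, b]%classic = `](a - c)%R, (b - c)%R]%classic.
  by apply/seteqP; split => x /=; rewrite !in_itv/= => /andP[h1 h2]; apply/andP; split; lra.
rewrite !lebesgue_measure_itv/= !lte_fin ltrD2r; case: ifP => // _.
by rewrite -!EFinB; congr EFin; ring.
Qed.

Lemma ge0_integral_shift (F : R -> \bar R) (c : R) :
  measurable_fun setT F -> (forall x, 0 <= F x) ->
  \int[leb]_x F (x + c)%R = \int[leb]_x F x.
Proof.
move=> mF F0.
have mshift : measurable_fun setT (fun x : measurableTypeR R => (x + c)%R : measurableTypeR R).
  exact: measurable_funD.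
have := @ge0_integral_pushforward _ _ _ _ _ _ mshift leb setT F measurableT mF
  (fun y _ => F0 y).
rewrite preimage_setT /= => <-.
by apply: eq_measure_integral => A mA _; exact: lebesgue_measure_shift.
Qed.

Lemma ge0_integral_opp (F : R -> \bar R) :
  measurable_fun setT F -> (forall x, 0 <= F x) ->
  \int[leb]_x F (- x)%R = \int[leb]_x F x.
Proof.
move=> mF F0.
have mopp : measurable_fun setT (-%R : measurableTypeR R -> measurableTypeR R).
  exact: oppr_measurable.
have := @ge0_integral_pushforward _ _ _ _ _ _ mopp leb setT F measurableT mF
  (fun y _ => F0 y).
rewrite preimage_setT /= => <-.
by apply: eq_measure_integral => A mA _; exact: lebesgue_measureN.
Qed.

Lemma ge0_integral_reflect (F : R -> \bar R) (c : R) :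
  measurable_fun setT F -> (forall x, 0 <= F x) ->
  \int[leb]_x F (c - x)%R = \int[leb]_x F x.
Proof.
move=> mF F0; rewrite -(ge0_integral_shift c mF F0).
rewrite -(@ge0_integral_opp (fun x => F (x + c)%R)) //.
- by apply: eq_integral => x _; rewrite addrC.
- by apply: measurableT_comp => //; exact: measurable_funD.
Qed.

End LebesgueInvariance.

(** * Integrals of arbitrary nonnegative functions and weighted changes of variables *)

Section IntegralExtras.
Local Open Scope ereal_scope.

(** The integral of a nonnegative function is a supremum over the simple functions below it, hence
    monotone for arbitrary functions. The supremum over z of |phihat w z - phi z| need not be
    measurable in w, and its expectation is bounded in this way. *)
Lemma ge0_le_integral_nonmeasurable d (T : measurableType d) (R : realType)
    (mu : {measure set T -> \bar R}) (f1 f2 : T -> \bar R) :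
  (forall x, 0 <= f1 x) -> (forall x, f1 x <= f2 x) ->
  \int[mu]_x f1 x <= \int[mu]_x f2 x.
Proof.
move=> f10 f12; have f20 x : 0 <= f2 x := le_trans (f10 x) (f12 x).
rewrite !ge0_integralTE//; apply: le_ereal_sup => _ [h hf <-].
by exists h => //= x; exact: le_trans (hf x) (f12 x).
Qed.

Import HBNNSimple.

(** The right-hand side sees [mu], [w] and [Y] only through the integrals of [w] over preimages
    under [Y]. Two weighted measures with the same image therefore give the same integral of g. *)
Lemma weighted_integral_approx d d' (T : measurableType d) (U : measurableType d')
    (R : realType) (mu : {measure set T -> \bar R}) (w : T -> R) (Y : T -> U) (g : U -> R)
    (mg : measurable_fun setT (EFin \o g)) :
  measurable_fun setT w -> (forall x, 0 <= w x)%R ->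
  measurable_fun setT Y -> (forall x, 0 <= g x)%R ->
  \int[mu]_x (w x * g (Y x))%:E =
  limn (fun n => \sum_(k \in range (nnsfun_approx measurableT mg n))
    (k%:E * \int[mu]_(x in Y @^-1` (nnsfun_approx measurableT mg n @^-1` [set k])) (w x)%:E)).
Proof.
move=> mw w0 mY g0; set g_ := nnsfun_approx measurableT mg.
have mgY n : measurable_fun setT (fun x => (w x * g_ n (Y x))%:E).
  by apply/measurable_EFinP/measurable_funM => //; apply: measurableT_comp.
transitivity (limn (fun n => \int[mu]_x (w x * g_ n (Y x))%:E)).
  rewrite -monotone_convergence//.
  - apply: eq_integral => x _; apply/esym/cvg_lim => //.
    under eq_fun do rewrite EFinM.
    rewrite EFinM; apply: cvgeZl => //.
    by apply: cvg_nnsfun_approx => // y _ /=; rewrite lee_fin.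
  - by move=> n x _; rewrite lee_fin mulr_ge0.
  - move=> x _ m n mn; rewrite lee_fin ler_wpM2l//.
    exact/lefP/nd_nnsfun_approx.
congr (limn _); apply/funext => n.
have mpre k : measurable (Y @^-1` (g_ n @^-1` [set k])).
  by rewrite -(setTI (_ @^-1` _)); apply: mY.
transitivity (\int[mu]_x (\sum_(k \in range (g_ n))
   (k * (w x * \1_(Y @^-1` (g_ n @^-1` [set k])) x))%:E)).
  apply: eq_integral => x _; rewrite fimfunE mulrC fsumEFin//; congr EFin.
  rewrite mulr_fsuml//; apply: eq_fsbigr => k _.
  by rewrite -mulrA; congr (_ * _)%R; rewrite mulrC; congr (_ * _)%R.
rewrite ge0_integral_fsum//=.
- apply: eq_fsbigr => k; rewrite inE => -[y _ <-].
  rewrite -ge0_integralZl//=.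
  + rewrite [RHS]integral_mkcond; apply: eq_integral => x _.
    rewrite /patch indicE -EFinM.
    by case: (x \in _); rewrite ?mulr1// !mulr0.
  + by apply/measurable_EFinP/measurable_funTS.
  + by move=> x _; rewrite lee_fin.
  + by rewrite lee_fin.
- by move=> k; apply/measurable_EFinP; do 2 apply: measurable_funM => //.
- move=> k x _; rewrite lee_fin indicE.
  have [|] := boolP (x \in _); last by rewrite !mulr0.
  rewrite inE/= => <-; rewrite mulr1 mulr_ge0//.
Qed.

(** Change of variables for the image under Y of the measure with density w. For products over a
    sample, w collects the factors of all the other observations. *)
Lemma eq_weighted_integral d d' (T : measurableType d) (U : measurableType d')
    (R : realType) (mu : {measure set T -> \bar R}) (nu : {measure set U -> \bar R})
    (w : T -> R) (Y : T -> U) (r g : U -> R) :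
  measurable_fun setT w -> (forall x, 0 <= w x)%R -> measurable_fun setT Y ->
  measurable_fun setT r -> (forall x, 0 <= r x)%R ->
  (forall B, measurable B ->
     \int[mu]_(x in Y @^-1` B) (w x)%:E = \int[nu]_(y in B) (r y)%:E) ->
  measurable_fun setT g -> (forall x, 0 <= g x)%R ->
  \int[mu]_x (w x * g (Y x))%:E = \int[nu]_y (r y * g y)%:E.
Proof.
move=> mw w0 mY mr r0 eqB mg g0.
have mgE : measurable_fun setT (EFin \o g) by exact/measurable_EFinP.
rewrite (weighted_integral_approx mu mgE)//.
rewrite (@weighted_integral_approx _ _ _ _ _ nu r id g mgE)//.
congr (limn _); apply/funext => n; apply: eq_fsbigr => k _.
by rewrite eqB.
Qed.

End IntegralExtras.

(** * The inner product on square integrable functions *)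

Section L2Space.
Variable R : realType.
Variables a b : R.
Local Notation leb := (@lebesgue_measure R).
Local Notation D := (Iab a b).
Local Notation L2 := (L2 a b).
Local Notation "<< g , h >>" := (inner a b g h).
Implicit Types g h u : R -> R.

Lemma measurable_Iab : measurable (D : set (measurableTypeR R)).
Proof. exact: measurable_itv. Qed.
Hint Resolve measurable_Iab : core.

Lemma IabE x : D x <-> a <= x <= b.
Proof. by rewrite /Iab /= in_itv. Qed.

Lemma lebesgue_Iab : a <= b -> leb D = (b - a)%:E.
Proof.
rewrite le_eqVlt => /predU1P[->|ab].
  by rewrite /Iab set_itv1 lebesgue_measure_set1 subrr.
by rewrite lebesgue_measure_itv/= lte_fin ab.
Qed.

Lemma lebesgue_Iab_lty : (leb D < +oo)%E.
Proof. by rewrite lebesgue_measure_itv/=; case: ifP => _; rewrite ?ltry. Qed.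

Lemma L2_sqr_integrable g : L2 g -> leb.-integrable D (EFin \o (fun x => g x ^+ 2)).
Proof.
move=> [mg ig]; apply/integrableP; split.
  by apply/measurable_EFinP; exact: measurable_funX.
under eq_integral do rewrite /= ger0_norm ?sqr_ge0//.
exact: ig.
Qed.

Lemma L2_mul_integrable g h : L2 g -> L2 h ->
  leb.-integrable D (EFin \o (fun x => g x * h x)).
Proof.
move=> Lg Lh; have [[mg _] [mh _]] := (Lg, Lh).
apply: (@le_integrable _ _ _ _ _ measurable_Iab _ (EFin \o (fun x => g x ^+ 2 + h x ^+ 2))) => //.
- by apply/measurable_EFinP; exact: measurable_funM.
- move=> x _ /=; rewrite lee_fin [leRHS]ger0_norm ?addr_ge0 ?sqr_ge0//.
  rewrite ler_norml; apply/andP; split.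
    by have := sqr_ge0 (g x + h x); have := sqr_ge0 (g x); have := sqr_ge0 (h x); nra.
  by have := sqr_ge0 (g x - h x); have := sqr_ge0 (g x); have := sqr_ge0 (h x); nra.
- rewrite (_ : _ \o _ = (EFin \o (fun x => (g x ^+ 2)%R)) \+ (EFin \o (fun x => (h x ^+ 2)%R)))%E //.
  by apply: integrableD => //; exact: L2_sqr_integrable.
Qed.

Lemma L2_le g (q : R -> R) : measurable_fun D g ->
  leb.-integrable D (EFin \o q) -> (forall x, D x -> g x ^+ 2 <= q x) -> L2 g.
Proof.
move=> mg iq gq; split => //; move/integrableP : iq => [mq iq].
apply: le_lt_trans iq; apply: ge0_le_integral => //.
- by move=> x _; rewrite lee_fin sqr_ge0.
- by apply/measurable_EFinP; exact: measurable_funX.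
- by apply: measurableT_comp.
- by move=> x Dx /=; rewrite lee_fin (le_trans (gq x Dx))// ler_norm.
Qed.

Lemma L2D g h : L2 g -> L2 h -> L2 (fun x => g x + h x).
Proof.
move=> Lg Lh; have [[mg _] [mh _]] := (Lg, Lh).
apply: (@L2_le _ (fun x => 2 * (g x ^+ 2) + 2 * (h x ^+ 2))).
- exact: measurable_funD.
- rewrite (_ : _ \o _ = (fun x => 2%:E * (EFin \o (fun x => (g x ^+ 2)%R)) x)
    \+ (fun x => 2%:E * (EFin \o (fun x => (h x ^+ 2)%R)) x))%E //.
  by apply: integrableD => //; apply: integrableZl => //; exact: L2_sqr_integrable.
- by move=> x _; have := sqr_ge0 (g x - h x); nra.
Qed.

Lemma L2Z c g : L2 g -> L2 (fun x => c * g x).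
Proof.
move=> Lg; have [mg _] := Lg.
apply: (@L2_le _ (fun x => c ^+ 2 * (g x ^+ 2))).
- exact: measurable_funM.
- rewrite (_ : _ \o _ = (fun x => (c ^+ 2)%:E * (EFin \o (fun x => (g x ^+ 2)%R)) x))%E //.
  by apply: integrableZl => //; exact: L2_sqr_integrable.
- by move=> x _; rewrite exprMn.
Qed.

Lemma eq_L2 g h : (forall x, D x -> g x = h x) -> L2 g -> L2 h.
Proof.
move=> gh [mg ig]; split.
  by apply: eq_measurable_fun mg => x; rewrite inE; exact: gh.
suff <- : (\int[leb]_(x in D) (g x ^+ 2)%:E = \int[leb]_(x in D) (h x ^+ 2)%:E)%E by [].
by apply: eq_integral => x; rewrite inE => Dx; rewrite gh.
Qed.

Lemma L2B g h : L2 g -> L2 h -> L2 (fun x => g x - h x).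
Proof.
move=> Lg /(L2Z (-1)) Lh; apply: eq_L2 (L2D Lg Lh) => x _.
by rewrite mulN1r.
Qed.

Lemma L2_0 : L2 (fun _ => 0).
Proof.
split; first exact: measurable_cst.
by rewrite integral0_eq// => x _; rewrite expr0n.
Qed.

Lemma L2_sum n (F : nat -> R -> R) : (forall k, L2 (F k)) ->
  L2 (fun x => \sum_(k < n) F k x).
Proof.
move=> LF; elim: n => [|n IH].
  by apply: eq_L2 L2_0 => x _; rewrite big_ord0.
by apply: eq_L2 (L2D IH (LF n)) => x _; rewrite big_ord_recr.
Qed.

Lemma integrable_cst_Iab (c : R) : leb.-integrable D (EFin \o cst c).
Proof.
apply/integrableP; split; first by apply/measurable_EFinP; exact: measurable_cst.
rewrite (_ : (fun x => _) = cst (`|c|%:E)) // integral_cst//.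
by rewrite lte_mul_pinfty ?lee_fin ?lebesgue_Iab_lty.
Qed.

Lemma L2_bounded g (B : R) : measurable_fun D g ->
  (forall x, D x -> `|g x| <= B) -> L2 g.
Proof.
move=> mg gB; apply: (@L2_le _ (cst (B ^+ 2))) => //.
  exact: integrable_cst_Iab.
move=> x Dx; rewrite -[g x ^+ 2]real_normK ?num_real// lerXn2r ?nnegrE ?gB//.
exact: le_trans (gB x Dx).
Qed.

Lemma L2_continuous g : {within D, continuous g} -> L2 g.
Proof.
move=> cg.
have mg : measurable_fun D g by apply: subspace_continuous_measurable_fun.
have cD : compact D by exact: segment_compact.
have /compact_bounded[M [_ mrt]] := continuous_compact cg cD.
apply: (@L2_bounded _ (M + 1)) => // x Dx.
by apply: (mrt (M + 1)); [rewrite ltrDl|exists x].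
Qed.

Lemma innerC g h : <<g, h>> = <<h, g>>.
Proof. by apply: eq_Rintegral => x _; rewrite mulrC. Qed.

Lemma eq_inner g g' h h' : (forall x, D x -> g x = g' x) ->
  (forall x, D x -> h x = h' x) -> <<g, h>> = <<g', h'>>.
Proof.
by move=> e1 e2; apply: eq_Rintegral => x; rewrite inE => Dx; rewrite e1// e2.
Qed.

Lemma innerDl g g' h : L2 g -> L2 g' -> L2 h ->
  <<(fun x => g x + g' x), h>> = <<g, h>> + <<g', h>>.
Proof.
move=> Lg Lg' Lh; rewrite /inner -RintegralD//; try exact: L2_mul_integrable.
by apply: eq_Rintegral => x _; rewrite mulrDl.
Qed.

Lemma innerZl c g h : L2 g -> L2 h -> <<(fun x => c * g x), h>> = c * <<g, h>>.
Proof.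
move=> Lg Lh; rewrite /inner -RintegralZl//; try exact: L2_mul_integrable.
by apply: eq_Rintegral => x _; rewrite mulrA.
Qed.

Lemma innerBl g g' h : L2 g -> L2 g' -> L2 h ->
  <<(fun x => g x - g' x), h>> = <<g, h>> - <<g', h>>.
Proof.
move=> Lg Lg' Lh; rewrite -mulN1r -innerZl// -innerDl//; last exact: L2Z.
by apply: eq_inner => // x _; rewrite mulN1r.
Qed.

Lemma inner0l h : <<(fun _ => 0), h>> = 0.
Proof.
by rewrite /inner /Rintegral integral0_eq// => x _; rewrite mul0r.
Qed.

Lemma inner_suml n (F : nat -> R -> R) h : (forall k, L2 (F k)) -> L2 h ->
  <<(fun x => \sum_(k < n) F k x), h>> = \sum_(k < n) <<F k, h>>.
Proof.
move=> LF Lh; elim: n => [|n IH].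
  rewrite big_ord0 -[RHS](inner0l h).
  by apply: eq_inner => // x _; rewrite big_ord0.
rewrite big_ord_recr/= -IH -innerDl//; last exact: L2_sum.
by apply: eq_inner => // x _; rewrite big_ord_recr.
Qed.

Lemma innerDr g g' h : L2 g -> L2 g' -> L2 h ->
  <<h, (fun x => g x + g' x)>> = <<h, g>> + <<h, g'>>.
Proof. by move=> *; rewrite innerC innerDl// !(innerC h). Qed.

Lemma innerBr g g' h : L2 g -> L2 g' -> L2 h ->
  <<h, (fun x => g x - g' x)>> = <<h, g>> - <<h, g'>>.
Proof. by move=> *; rewrite innerC innerBl// !(innerC h). Qed.

Lemma innerZr c g h : L2 g -> L2 h -> <<h, (fun x => c * g x)>> = c * <<h, g>>.
Proof. by move=> *; rewrite innerC innerZl// (innerC h). Qed.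

Lemma inner_sumr n (F : nat -> R -> R) h : (forall k, L2 (F k)) -> L2 h ->
  <<h, (fun x => \sum_(k < n) F k x)>> = \sum_(k < n) <<h, F k>>.
Proof.
by move=> *; rewrite innerC inner_suml//; apply: eq_bigr => k _; rewrite innerC.
Qed.

Lemma inner_ge0 g : 0 <= <<g, g>>.
Proof. by apply: Rintegral_ge0 => x _; rewrite -expr2 sqr_ge0. Qed.

Lemma L2normE g : L2norm a b g = Num.sqrt <<g, g>>.
Proof. by congr Num.sqrt; apply: eq_Rintegral => x _; rewrite expr2. Qed.

Lemma sqr_L2norm g : L2norm a b g ^+ 2 = <<g, g>>.
Proof. by rewrite L2normE sqr_sqrtr ?inner_ge0. Qed.

Lemma L2norm_ge0 g : 0 <= L2norm a b g.
Proof. by rewrite L2normE sqrtr_ge0. Qed.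

Lemma inner_sqr_integral g : L2 g ->
  (<<g, g>>)%:E = (\int[leb]_(x in D) (g x ^+ 2)%:E)%E.
Proof.
move=> Lg; rewrite /inner /Rintegral fineK.
  by apply: eq_integral => x _; rewrite expr2.
by apply: integrable_fin_num => //; exact: L2_mul_integrable.
Qed.

(** Expand t |h - g / (2t)|^2 >= 0. The free parameter t lets the energy estimate absorb a term
    alpha |h|^2 exactly. *)
Lemma inner_Young g h t : 0 < t -> L2 g -> L2 h ->
  <<g, h>> <= t * <<h, h>> + <<g, g>> / (4 * t).
Proof.
move=> t0 Lg Lh.
pose c := (2 * t)^-1.
have := inner_ge0 (fun x => h x - c * g x).
have Lcg : L2 (fun x => c * g x) by exact: L2Z.
have LB : L2 (fun x => h x - c * g x) by exact: L2B.
rewrite innerBl// !innerBr// !innerZl// !innerZr// (innerC h g).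
have -> : <<g, g>> / (4 * t) = t * (c * (c * <<g, g>>)).
  by rewrite /c; field; lra.
have tc : t * c = 2^-1 by rewrite /c; field; lra.
move=> /(mulr_ge0 (ltW t0)) h0.
have -> : <<g, h>> = 2 * (t * c) * <<g, h>> by rewrite tc; field.
rewrite -subr_ge0; apply: le_trans h0 _.
by rewrite le_eqVlt; apply/orP; left; apply/eqP; ring.
Qed.

(** Letting t tend to 0 in [inner_Young] gives <g, k> <= 0 for every k; k = h and k = -h together
    give equality. *)
Lemma inner_null g h : L2 g -> L2 h -> <<g, g>> = 0 -> <<g, h>> = 0.
Proof.
move=> Lg Lh g0.
have le0 k : L2 k -> <<g, k>> <= 0.
  move=> Lk; apply/ler_addgt0Pl => e e0; rewrite addr0.
  have h0 := inner_ge0 k.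
  have t0 : 0 < e / (1 + <<k, k>>) by rewrite divr_gt0// ltr_pwDl.
  have := inner_Young t0 Lg Lk; rewrite g0 mul0r addr0 => /le_trans; apply.
  rewrite -mulrA ler_piMr ?(ltW e0)// mulrC ler_pdivrMr; lra.
apply/le_anti/andP; split; first exact: le0.
have := le0 _ (L2Z (-1) Lh); rewrite innerZr//; lra.
Qed.

Lemma inner_sqrD_le g h : L2 g -> L2 h ->
  <<(fun x => g x + h x), (fun x => g x + h x)>> <= 2 * <<g, g>> + 2 * <<h, h>>.
Proof.
move=> Lg Lh; have := inner_ge0 (fun x => g x - h x).
rewrite innerBl ?innerBr//; try exact: L2B.
rewrite innerDl ?innerDr//; try exact: L2D.
rewrite (innerC h g); lra.
Qed.

End L2Space.

(** * The kernel sections f(. - z) and the sup-norm bound for T^* *)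

Section Operators.
Variable R : realType.
Variables (a b : R) (f : R -> R).
Local Notation leb := (@lebesgue_measure R).
Local Notation D := (Iab a b).
Local Notation L2 := (L2 a b).
Local Notation "<< g , h >>" := (inner a b g h).
Local Notation T := (Top a b f).
Local Notation Ts := (Tstar a b f).
Implicit Types g h u : R -> R.
Hint Resolve measurable_Iab : core.

Hypothesis mf : measurable_fun setT f.
Hypothesis f0 : forall x, 0 <= f x.
Hypothesis intf : (\int[leb]_x (f x)%:E = 1)%E.

Lemma TopE g y : T g y = <<g, (fun z => f (y - z))>>.
Proof. by []. Qed.

Lemma TstarE g z : Ts g z = <<g, (fun y => f (y - z))>>.
Proof. by []. Qed.

Let mfE : measurable_fun setT (EFin \o f). Proof. exact/measurable_EFinP. Qed.
Let f0E x : (0 <= (EFin \o f) x)%E. Proof. by rewrite /= lee_fin. Qed.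

Lemma measurable_kernel_y z : measurable_fun setT (fun y : R => f (y - z)).
Proof. by apply: measurableT_comp => //; exact: measurable_funB. Qed.

Lemma measurable_kernel_z y : measurable_fun setT (fun z : R => f (y - z)).
Proof. by apply: measurableT_comp => //; exact: measurable_funB. Qed.

Lemma integral_kernel_y z : (\int[leb]_y (f (y - z))%:E = 1)%E.
Proof. by rewrite -intf -(ge0_integral_shift (- z) mfE f0E). Qed.

Lemma integral_kernel_z y : (\int[leb]_z (f (y - z))%:E = 1)%E.
Proof. by rewrite -intf -(ge0_integral_reflect y mfE f0E). Qed.

Lemma integral_kernel_y_le1 z : (\int[leb]_(y in D) (f (y - z))%:E <= 1)%E.
Proof.
rewrite -(integral_kernel_y z); apply: ge0_subset_integral => //.
  by apply/measurable_EFinP; exact: measurable_kernel_y.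
by move=> x _; rewrite lee_fin.
Qed.

Lemma integrable_kernel_y z : leb.-integrable D (EFin \o (fun y => f (y - z))).
Proof.
apply/integrableP; split.
  by apply/measurable_EFinP; apply: measurable_funTS; exact: measurable_kernel_y.
under eq_integral do rewrite /= ger0_norm//.
by apply: le_lt_trans (integral_kernel_y_le1 z) _; rewrite ltry.
Qed.

Lemma Tstar_le_of_integrable (C : R) g z :
  (opnormTstar2inf a b f <= C%:E)%E -> D z -> L2 g ->
  leb.-integrable D (EFin \o (fun y => g y * f (y - z))) ->
  `|Ts g z| <= C * L2norm a b g.
Proof.
move=> opC Dz Lg ig.
(* A scale t strictly above the norm avoids dividing by 0 when the norm of g vanishes; afterwards t
   decreases to the norm. *)
have key t : L2norm a b g < t -> `|Ts g z| <= C * t.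
  move=> gt; have t0 : 0 < t := le_lt_trans (L2norm_ge0 a b g) gt.
  pose g' x := t^-1 * g x.
  have Lg' : L2 g' by exact: L2Z.
  have ng' : L2norm a b g' <= 1.
    rewrite L2normE innerZl// innerZr// mulrA -expr2 sqrtrM ?sqr_ge0//.
    rewrite sqrtr_sqr ger0_norm ?invr_ge0 ?(ltW t0)//.
    by rewrite mulrC -L2normE ler_pdivrMr// mul1r ltW.
  have : ((`|Ts g' z|)%:E <= C%:E)%E.
    apply: le_trans opC.
    apply: (@le_trans _ _ (supnorm a b (Ts g'))).
      by apply: ereal_sup_ubound; exists z.
    by apply: ereal_sup_ubound; exists g'.
  rewrite lee_fin; have -> : Ts g' z = t^-1 * Ts g z.
    rewrite /Tstar -RintegralZl//; apply: eq_Rintegral => y _.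
    by rewrite mulrA.
  by rewrite normrM ger0_norm ?invr_ge0 ?(ltW t0)// mulrC ler_pdivrMr.
have C0 : 0 <= C.
  have /key := ltr_pwDr ltr01 (lexx (L2norm a b g)).
  move=> /(le_trans (normr_ge0 _)); rewrite pmulr_lge0//.
  by rewrite (le_lt_trans (L2norm_ge0 a b g))// ltrDl.
apply/ler_addgt0Pl => e e0.
have e' : 0 < e / (C + 1) by rewrite divr_gt0// ltr_wpDl.
have /key/le_trans := ltr_pwDr e' (lexx (L2norm a b g)); apply.
rewrite mulrDr addrC lerD2r mulrCA ler_piMr ?(ltW e0)//.
by rewrite ler_pdivrMr ?ltr_wpDl// mul1r lerDl.
Qed.

(* Testing T^* against the truncations min(f(. - z), n) bounds their L2 norms
   by C, and monotone convergence passes to f(. - z) itself.  Truncating first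
   matters: a divergent Rintegral is 0, so f(. - z) cannot be tested directly. *)
Lemma L2_kernel_y (C : R) z : (opnormTstar2inf a b f <= C%:E)%E -> D z ->
  L2 (fun y => f (y - z)).
Proof.
move=> opC Dz; set fz := fun y => f (y - z).
have mfz : measurable_fun D fz by apply: measurable_funTS; exact: measurable_kernel_y.
have fz0 y : 0 <= fz y by exact: f0.
pose g (n : nat) y := Num.min (fz y) n%:R.
have g0 n y : 0 <= g n y by rewrite le_min fz0 ler0n.
have mg n : measurable_fun D (g n) by apply: measurable_minr.
have gfz n y : g n y <= fz y by rewrite ge_min lexx.
have Lg n : L2 (g n).
  apply: (@L2_bounded _ _ _ _ n%:R) => // y _.
  by rewrite ger0_norm// ge_min lexx orbT.
have ig n : leb.-integrable D (EFin \o (fun y => g n y * fz y)).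
  apply: (@le_integrable _ _ _ _ _ (@measurable_Iab _ a b) _ (fun y => n%:R%:E * (EFin \o fz) y))%E.
  - by apply/measurable_EFinP; apply: measurable_funM; [exact: mg|exact: mfz].
  - move=> y _ /=; rewrite lee_fin !ger0_norm ?mulr_ge0 ?ler0n//.
    by rewrite ler_wpM2r// ge_min lexx orbT.
  - by apply: integrableZl => //; exact: integrable_kernel_y.
(* Since g_n <= f(. - z), |g_n|^2 <= <g_n, f(. - z)> = (T^* g_n)(z) <= C |g_n|, and one factor |g_n|
   cancels. *)
have qC n : <<g n, g n>> <= C ^+ 2.
  have h1 : <<g n, g n>> <= Ts (g n) z.
    apply: le_Rintegral => //; first exact: L2_mul_integrable.
    by move=> y _; rewrite ler_wpM2l.
  have h2 := Tstar_le_of_integrable opC Dz (Lg n) (ig n).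
  have {h1 h2}h := le_trans h1 (le_trans (ler_norm _) h2).
  rewrite -sqr_L2norm; move: h; rewrite -sqr_L2norm.
  have := L2norm_ge0 a b (g n); set x := L2norm _ _ _ => x0 h.
  have [x0'|xC] := leP x C; first by rewrite lerXn2r// nnegrE (le_trans x0).
  have xp : 0 <= x by [].
  by move: h xC; nra.
split => //.
have -> : (\int[leb]_(y in D) (fz y ^+ 2)%:E =
    limn (fun n => \int[leb]_(y in D) (g n y ^+ 2)%:E))%E.
  rewrite -monotone_convergence//.
  - apply: eq_integral => y _; apply/esym/cvg_lim => //.
    apply: cvg_near_cst; near=> n; congr (_ ^+ 2)%:E.
    rewrite /g minEle; case: ifPn => //; rewrite -ltNge => h.
    have : fz y <= n%:R by near: n; exact: nbhs_infty_ger.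
    by move=> h'; apply/eqP; rewrite eq_le h' ltW.
  - by move=> n; apply/measurable_EFinP; apply: measurable_funX; exact: mg.
  - by move=> n y _; rewrite lee_fin sqr_ge0.
  - move=> y _ m n mn; rewrite lee_fin lerXn2r ?nnegrE//.
    by rewrite le_min ge_min lexx/= ge_min ler_nat mn orbT.
apply: (@le_lt_trans _ _ (C ^+ 2)%:E); last by rewrite ltry.
apply: lime_le.
  apply: ereal_nondecreasing_is_cvgn => m n mn.
  apply: ge0_le_integral => //.
  - by move=> y _; rewrite lee_fin sqr_ge0.
  - by apply/measurable_EFinP; apply: measurable_funX; exact: mg.
  - by apply/measurable_EFinP; apply: measurable_funX; exact: mg.
  - move=> y _; rewrite lee_fin lerXn2r ?nnegrE//.
    by rewrite le_min ge_min lexx/= ge_min ler_nat mn orbT.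
by apply: nearW => n; rewrite -inner_sqr_integral// lee_fin.
Unshelve. all: by end_near. Qed.

End Operators.

(** * Square integrability of f(y - .), contraction of T, and adjointness *)

Section Adjoint.
Variable R : realType.
Variables (a b : R) (f : R -> R).
Local Notation leb := (@lebesgue_measure R).
Local Notation D := (Iab a b).
Local Notation L2 := (L2 a b).
Local Notation "<< g , h >>" := (inner a b g h).
Local Notation T := (Top a b f).
Local Notation Ts := (Tstar a b f).
Implicit Types g h u : R -> R.
Hint Resolve measurable_Iab : core.

Hypothesis mf : measurable_fun setT f.
Hypothesis f0 : forall x, 0 <= f x.
Hypothesis intf : (\int[leb]_x (f x)%:E = 1)%E.
Hypothesis ab : a <= b.
Hypothesis Lky : forall z, D z -> L2 (fun y => f (y - z)).

Let F (c d x : R) := (f x ^+ 2 * \1_(Iab c d) x)%:E.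

Let mF c d : measurable_fun setT (F c d).
Proof.
apply/measurable_EFinP; apply: measurable_funM.
  by apply: measurable_funX; exact: mf.
by apply: measurable_indic; exact: measurable_Iab.
Qed.

Let F0 c d x : (0 <= F c d x)%E.
Proof. by rewrite lee_fin mulr_ge0 ?sqr_ge0// indicE. Qed.

Let F_lty z : D z -> (\int[leb]_x F (a - z) (b - z) x < +oo)%E.
Proof.
move=> Dz; rewrite -(ge0_integral_shift (- z) (mF _ _) (F0 _ _)).
have [_] := Lky Dz; rewrite integral_mkcond.
set I1 := (\int[leb]_x _)%E; set I2 := (\int[leb]_x _)%E.
suff -> : I1 = I2 by [].
apply: eq_integral => x _; rewrite /F /patch indicE.
have -> : ((x - z)%R \in Iab (a - z) (b - z)) = (x \in D).
  by apply/idP/idP; rewrite !inE /Iab /= !in_itv/= !lerD2r.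
by case: (x \in D); rewrite ?mulr1// mulr0.
Qed.

(* On [a, b] x [a, b] the difference y - z ranges over [a - b, b - a], and the
   sections at z = b and z = a cover the two halves of that interval. *)
Lemma L2_kernel_z y : D y -> L2 (fun z => f (y - z)).
Proof.
move=> /IabE Dy; split.
  by apply: measurable_funTS; exact: measurable_kernel_z.
have Da : D a by apply/IabE; rewrite lexx.
have Db : D b by apply/IabE; rewrite lexx ab.
apply: (@le_lt_trans _ _ (\int[leb]_z (F (a - b) (b - b) (y - z)%R +
                                       F (a - a) (b - a) (y - z)%R))%E).
  rewrite integral_mkcond; apply: ge0_le_integral_nonmeasurable.
    by move=> x; apply: erestrict_ge0 => z _; rewrite lee_fin sqr_ge0.
  move=> z; rewrite /patch; case: ifPn => [|_]; last by rewrite adde_ge0.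
  rewrite inE => /IabE Dz; rewrite /F -EFinD lee_fin -mulrDr ler_peMr ?sqr_ge0//.
  have /orP[h|h] := le_total z y.
    rewrite [X in _ + X]indicE mem_set ?lerDr ?indicE//.
    by apply/IabE; apply/andP; split; lra.
  rewrite [X in X + _]indicE mem_set ?lerDl ?indicE//.
  by apply/IabE; apply/andP; split; lra.
have mFy c d : measurable_fun setT (fun z : R => F c d (y - z)).
  by apply: measurableT_comp => //; exact: measurable_funB.
rewrite ge0_integralD//; try exact: mFy; try by move=> *; exact: F0.
rewrite !ge0_integral_reflect//.
by rewrite lte_add_pinfty// F_lty.
Qed.

(** Extension by 0, so that Tonelli's theorem is applied on the whole plane, where every section of
    the kernel has mass exactly 1. *)
Let ext g : R -> R := g \_ D.

Let mext g : L2 g -> measurable_fun setT (ext g).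
Proof. by move=> [mg _]; apply: (measurable_restrictT _ (measurable_Iab a b)).1. Qed.

Let extE g x : D x -> ext g x = g x.
Proof. by move=> Dx; rewrite /ext /patch mem_set. Qed.

Let ext0 g x : ~ D x -> ext g x = 0.
Proof. by move=> Dx; rewrite /ext /patch memNset. Qed.

Let int_ext_sqr g : (\int[leb]_x (ext g x ^+ 2)%:E = \int[leb]_(x in D) (g x ^+ 2)%:E)%E.
Proof.
rewrite [RHS]integral_mkcond; apply: eq_integral => x _.
by rewrite /ext /patch; case: ifP => //; rewrite expr0n.
Qed.

Let mker : measurable_fun setT (fun x : R * R => f (x.1 - x.2)).
Proof. by apply: measurableT_comp => //; apply: measurable_funB. Qed.

Lemma Tonelli_kernel_sqr g : L2 g ->
  (\int[leb]_y \int[leb]_z (ext g z ^+ 2 * f (y - z))%:E =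
   \int[leb]_(z in D) (g z ^+ 2)%:E)%E.
Proof.
move=> Lg.
have mG : measurable_fun setT (fun x : R * R => (ext g x.2 ^+ 2 * f (x.1 - x.2))%:E).
  apply/measurable_EFinP; apply: measurable_funM => //.
  apply: measurable_funX; apply: measurableT_comp; last exact: measurable_snd.
  exact: mext.
rewrite -int_ext_sqr.
rewrite (fubini_tonelli (m1 := leb) (m2 := leb) (fun x : R * R => (ext g x.2 ^+ 2 * f (x.1 - x.2))%:E))//; last first.
  by move=> x; rewrite lee_fin mulr_ge0// sqr_ge0.
apply: eq_integral => z _ /=.
under eq_integral do rewrite EFinM.
rewrite ge0_integralZl ?lee_fin ?sqr_ge0//.
- by rewrite integral_kernel_y// mule1.
- by apply/measurable_EFinP; exact: measurable_kernel_y.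
- by move=> x _; rewrite lee_fin.
Qed.

Let amgm (t x : R) : 0 < t -> x <= (2 * t)^-1 * x ^+ 2 + t / 2.
Proof.
move=> t0; rewrite -subr_ge0.
have -> : (2 * t)^-1 * x ^+ 2 + t / 2 - x = (2 * t)^-1 * (x - t) ^+ 2 by field; lra.
by rewrite mulr_ge0 ?sqr_ge0// invr_ge0; lra.
Qed.

Let amgm_conv (t r : R) : 0 < t -> t <= (2 * t)^-1 * r + t / 2 -> t ^+ 2 <= r.
Proof.
move=> t0 h; have : t / 2 <= (2 * t)^-1 * r by lra.
rewrite mulrC [X in _ <= X]mulrC ler_pdivlMr; last by lra.
by rewrite expr2; lra.
Qed.

(* Jensen's inequality for the sub-probability density f(y - .), by AM-GM. *)
Lemma sqr_Top_le g y : L2 g ->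
  (((T g y) ^+ 2)%:E <= \int[leb]_z (ext g z ^+ 2 * f (y - z))%:E)%E.
Proof.
move=> Lg; have mg' := mext Lg.
have mk := measurable_kernel_z mf y.
set I := (\int[leb]_z _)%E.
have I0 : (0 <= I)%E by apply: integral_ge0 => z _; rewrite lee_fin mulr_ge0// sqr_ge0.
have TE : T g y = fine (\int[leb]_z (ext g z * f (y - z))%:E)%E.
  rewrite /Top /Rintegral integral_mkcond; congr fine; apply: eq_integral => z _.
  by rewrite /ext /patch; case: ifP => //; rewrite mul0r.
(* Integrating |x| <= x^2 / (2t) + t / 2 against f(y - .), of mass 1, gives t <= I / (2t) + t / 2,
   that is t^2 <= I. The value t of the parameter is the one that makes this close. *)
pose t := `|T g y|.
rewrite -(real_normK (num_real (T g y))) -/t.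
have [t0|] := ltP 0 t; last first.
  move=> t0; have -> : t = 0 by apply/le_anti; rewrite t0 normr_ge0.
  by rewrite expr0n.
have h1 : (t%:E <= \int[leb]_z ((2 * t)^-1%:E * (ext g z ^+ 2 * f (y - z))%:E + (t / 2)%:E * (f (y - z))%:E))%E.
  apply: (@le_trans _ _ (\int[leb]_z `|(ext g z * f (y - z))%:E|)%E).
    apply: (@le_trans _ _ `|\int[leb]_z (ext g z * f (y - z))%:E|%E).
      (* An infinite integral has [fine] equal to 0, so only the finite case carries content. *)
      rewrite /t TE; case: (\int[leb]_z _)%E => [r| |] //=.
        by rewrite normr0 leey.
      by rewrite normr0 leey.
    apply: le_abse_integral => //.
    by apply/measurable_EFinP; apply: measurable_funM.
  apply: ge0_le_integral_nonmeasurable => // z.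
  rewrite -!EFinM -EFinD /= lee_fin normrM (ger0_norm (f0 _)) mulrA -mulrDl ler_wpM2r//.
  rewrite -[ext g z ^+ 2]real_normK ?num_real//; set x := `|ext g z|.
  exact: amgm.
have t20 : 0 <= (2 * t)^-1 by rewrite invr_ge0 mulr_ge0// ltW.
have t02 : 0 <= t / 2 by rewrite divr_ge0// ltW.
move: h1; rewrite ge0_integralD//; last 4 first.
- by move=> z _; apply: mule_ge0; rewrite lee_fin// mulr_ge0 ?sqr_ge0.
- apply: measurable_funeM; apply/measurable_EFinP; apply: measurable_funM => //.
  by apply: measurable_funX; exact: mg'.
- by move=> z _; rewrite -EFinM lee_fin mulr_ge0.
- by apply: measurable_funeM; apply/measurable_EFinP.
rewrite ge0_integralZl//; last 2 first.
- apply/measurable_EFinP; apply: measurable_funM => //.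
  by apply: measurable_funX; exact: mg'.
- by move=> z _; rewrite lee_fin mulr_ge0// sqr_ge0.
rewrite ge0_integralZl//; last 2 first.
- exact/measurable_EFinP.
- by move=> z _; rewrite lee_fin.
rewrite integral_kernel_z// mule1 -/I.
case: I I0 => [r| |] // _; last by rewrite leey.
by rewrite -EFinM -EFinD !lee_fin; exact: amgm_conv.
Qed.

Lemma integral_sqr_Top_le g : L2 g ->
  (\int[leb]_(y in D) (T g y ^+ 2)%:E <= \int[leb]_(z in D) (g z ^+ 2)%:E)%E.
Proof.
move=> Lg; rewrite -(Tonelli_kernel_sqr Lg) integral_mkcond.
apply: ge0_le_integral_nonmeasurable => y; rewrite /patch.
  by case: ifP => // _; rewrite lee_fin sqr_ge0.
case: ifP => // _; first exact: sqr_Top_le.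
by apply: integral_ge0 => z _; rewrite lee_fin mulr_ge0// sqr_ge0.
Qed.

Lemma L2_Top g : L2 g -> L2 (T g).
Proof.
move=> Lg; have mg' := mext Lg.
have mTg : measurable_fun setT (T g).
  have -> : T g = fine \o (fun y => \int[leb]_z (ext g z * f (y - z))%:E)%E.
    apply/funext => y /=; rewrite /Top /Rintegral integral_mkcond; congr fine.
    apply: eq_integral => z _.
    by rewrite /ext /patch; case: ifP => //; rewrite mul0r.
  apply: measurableT_comp => //.
  have mG : measurable_fun setT (fun x : R * R => (ext g x.2 * f (x.1 - x.2))%:E).
    apply/measurable_EFinP; apply: measurable_funM => //.
    by apply: measurableT_comp; [exact: mext|exact: measurable_snd].
  apply: (@measurable_fubini_F _ _ _ _ _ leb leb (fun x : R * R => (ext g x.2 * f (x.1 - x.2))%:E)).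
  apply/(integrable21ltyP leb leb mG).
  have -> : (\int[leb]_y \int[leb]_x `|(ext g y * f (x - y))%:E| = \int[leb]_(y in D) `|(g y)%:E|)%E.
    rewrite [RHS]integral_mkcond; apply: eq_integral => z _ /=.
    under eq_integral do rewrite normrM (ger0_norm (f0 _)) EFinM.
    rewrite ge0_integralZl ?lee_fin ?normr_ge0//.
    - rewrite integral_kernel_y// mule1 /ext /patch.
      by case: ifP => //; rewrite normr0.
    - by apply/measurable_EFinP; exact: measurable_kernel_y.
    - by move=> x _; rewrite lee_fin.
  (* On a bounded interval L2 is contained in L1: pair g with the constant 1. *)
  have /integrableP[_ ig] : leb.-integrable D (EFin \o (fun x => g x * 1)).
    by apply: L2_mul_integrable => //; apply: (@L2_bounded _ _ _ _ 1) => // x _; rewrite normr1.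
  apply: le_lt_trans ig; rewrite le_eqVlt; apply/orP; left; apply/eqP.
  by apply: eq_integral => x _ /=; rewrite mulr1.
split; first exact: measurable_funTS.
apply: (@le_lt_trans _ _ (\int[leb]_(z in D) (g z ^+ 2)%:E)%E); last by case: Lg.
exact: integral_sqr_Top_le.
Qed.

Lemma Top_contraction g : L2 g -> <<T g, T g>> <= <<g, g>>.
Proof.
move=> Lg; have LT := L2_Top Lg.
rewrite -lee_fin !inner_sqr_integral//.
exact: integral_sqr_Top_le.
Qed.

Let adj_integrand g h (x : R * R) := (ext g x.2 * ext h x.1 * f (x.1 - x.2))%:E.

Let madj g h : L2 g -> L2 h -> measurable_fun setT (adj_integrand g h).
Proof.
move=> Lg Lh; apply/measurable_EFinP; apply: measurable_funM => //.
apply: measurable_funM; apply: measurableT_comp; try exact: mext.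
- exact: measurable_snd.
- exact: measurable_fst.
Qed.

(** Dominate |g(z) h(y)| by g(z)^2 + h(y)^2. Against f(y - z), the first term integrates to |g|^2 by
    Tonelli, and the second to |h|^2 because f(y - .) has mass 1. *)
Let iadj g h : L2 g -> L2 h -> (leb \x leb)%E.-integrable setT (adj_integrand g h).
Proof.
move=> Lg Lh; apply/(integrable12ltyP leb leb (madj Lg Lh)).
apply: (@le_lt_trans _ _ (\int[leb]_y (\int[leb]_z (ext g z ^+ 2 * f (y - z))%:E + (ext h y ^+ 2)%:E)%E)%E).
  apply: ge0_le_integral_nonmeasurable => y.
    by apply: integral_ge0.
  rewrite -[X in (_ + X)%E]mule1 -(integral_kernel_z mf f0 intf y).
  rewrite -ge0_integralZl//; last 3 first.
  - by apply/measurable_EFinP; exact: measurable_kernel_z.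
  - by move=> z _; rewrite lee_fin.
  - by rewrite lee_fin sqr_ge0.
  rewrite -ge0_integralD//; last 4 first.
  - by move=> z _; rewrite lee_fin mulr_ge0// sqr_ge0.
  - apply/measurable_EFinP; apply: measurable_funM; last exact: measurable_kernel_z.
    by apply: measurable_funX; exact: mext.
  - by move=> z _; rewrite -EFinM lee_fin mulr_ge0// sqr_ge0.
  - by apply: measurable_funeM; apply/measurable_EFinP; exact: measurable_kernel_z.
  apply: ge0_le_integral_nonmeasurable => // z.
  rewrite /adj_integrand /= -EFinM -EFinD lee_fin !normrM (ger0_norm (f0 _)) -mulrDl ler_wpM2r//.
  rewrite -[ext g z ^+ 2]real_normK ?num_real// -[ext h y ^+ 2]real_normK ?num_real//.
  by have := sqr_ge0 (`|ext g z| - `|ext h y|); have := normr_ge0 (ext g z); have := normr_ge0 (ext h y); nra.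
rewrite ge0_integralD//; last 4 first.
- by move=> y _; apply: integral_ge0 => z _; rewrite lee_fin mulr_ge0// sqr_ge0.
- apply: (measurable_fun_fubini_tonelli_F (m2 := leb) (fun x : R * R => (ext g x.2 ^+ 2 * f (x.1 - x.2))%:E)).
    apply/measurable_EFinP; apply: measurable_funM => //.
    apply: measurable_funX; apply: measurableT_comp; last exact: measurable_snd.
    exact: mext.
  by move=> x; rewrite lee_fin mulr_ge0// sqr_ge0.
- by move=> y _; rewrite lee_fin sqr_ge0.
- by apply/measurable_EFinP; apply: measurable_funX; exact: mext.
rewrite Tonelli_kernel_sqr// int_ext_sqr lte_add_pinfty//.
- by case: Lg.
- by case: Lh.
Qed.

Lemma Top_adjoint g h : L2 g -> L2 h -> <<T g, h>> = <<g, Ts h>>.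
Proof.
move=> Lg Lh.
have := Fubini (iadj Lg Lh) => /= H.
have -> : <<T g, h>> = fine (\int[leb]_y \int[leb]_z adj_integrand g h (y, z))%E.
  rewrite /inner /Rintegral integral_mkcond; congr fine; apply: eq_integral => y _.
  rewrite /patch; case: ifPn => [|/negP]; rewrite inE => Dy; last first.
    by rewrite integral0_eq// => z _; rewrite /adj_integrand/= (ext0 _ Dy) mulr0 mul0r.
  (* Removing the [fine] of the inner integral requires it to be finite, which is where the square
     integrability of the kernel section at y enters. *)
  rewrite mulrC EFinM [X in (_ * X)%E]fineK; last first.
    exact: (integrable_fin_num (measurable_Iab a b) (L2_mul_integrable Lg (L2_kernel_z Dy))).
  rewrite -(integralZl (measurable_Iab a b)); last exact: (L2_mul_integrable Lg (L2_kernel_z Dy)).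
  rewrite integral_mkcond; apply: eq_integral => z _.
  rewrite /adj_integrand /= (extE _ Dy) /ext /patch; case: ifP => _; last by rewrite !mul0r.
  by rewrite -EFinM mulrA; congr (_ * _)%:E; rewrite mulrC.
rewrite H /inner [in RHS]/Rintegral integral_mkcond; congr fine; apply: eq_integral => z _.
rewrite /patch; case: ifPn => [|/negP]; rewrite inE => Dz; last first.
  by rewrite integral0_eq// => y _; rewrite /adj_integrand/= (ext0 _ Dz) !mul0r.
rewrite EFinM [X in (_ * X)%E]fineK; last first.
  exact: (integrable_fin_num (measurable_Iab a b) (L2_mul_integrable Lh (Lky Dz))).
rewrite -(integralZl (measurable_Iab a b)); last exact: (L2_mul_integrable Lh (Lky Dz)).
rewrite [RHS]integral_mkcond; apply: eq_integral => y _.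
rewrite /adj_integrand /= (extE _ Dz) /ext /patch; case: ifP => _; last by rewrite mulr0 mul0r.
by rewrite -EFinM mulrA.
Qed.

End Adjoint.

(** * From bounds up to an L2-small error to pointwise bounds *)

Section L2Limit.
Variable R : realType.
Variables (a b : R).
Local Notation leb := (@lebesgue_measure R).
Local Notation D := (Iab a b).
Local Notation L2 := (L2 a b).
Local Notation "<< g , h >>" := (inner a b g h).
Hint Resolve measurable_Iab : core.

(** The point z may be an endpoint, so the interval is one-sided: to the right of z, or to the left
    when z = b. *)
Lemma within_continuous_interval (v : R -> R) z e : a < b -> D z -> 0 < e ->
  {within D, continuous v} ->
  exists c d, [/\ c < d, Iab c d `<=` D & forall x, Iab c d x -> `|v x - v z| < e].
Proof.
move=> ab Dz e0 /subspace_continuousP/(_ z Dz) cv.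
have /IabE/andP[az zb] := Dz.
have : \forall x \near within D (nbhs z), `|v x - v z| < e.
  by move/cvgrPdistC_lt : cv; exact.
rewrite near_withinE /= => -[r /= r0 rP].
have [zb'|bz] := ltP z b.
- exists z, (Num.min b (z + r / 2)); split.
  + by rewrite lt_min zb' ltrDl; lra.
  + move=> x /IabE/andP[zx]; rewrite le_min => /andP[xb _].
    by apply/IabE; rewrite xb (le_trans az).
  + move=> x /IabE/andP[zx]; rewrite le_min => /andP[xb xr].
    apply: rP; last by apply/IabE; rewrite xb (le_trans az).
    by rewrite /ball /= distrC ger0_norm; lra.
- have zbE : z = b by lra.
  exists (Num.max a (z - r / 2)), z; split.
  + by rewrite gt_max; apply/andP; split; lra.
  + move=> x /IabE/andP[]; rewrite ge_max => /andP[ax _] xz.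
    by apply/IabE; rewrite ax (le_trans xz).
  + move=> x /IabE/andP[]; rewrite ge_max => /andP[ax xr] xz.
    apply: rP; last by apply/IabE; rewrite ax (le_trans xz).
    by rewrite /ball /= ger0_norm; lra.
Qed.

Lemma inner_ge_interval (q : R -> R) c d e : c <= d -> 0 <= e -> Iab c d `<=` D ->
  L2 q -> (forall x, Iab c d x -> e <= `|q x|) -> e ^+ 2 * (d - c) <= <<q, q>>.
Proof.
move=> cd e0 sub Lq qe; rewrite -lee_fin inner_sqr_integral//.
have mq2 : measurable_fun D (fun x => (q x ^+ 2)%:E).
  by apply/measurable_EFinP; apply: measurable_funX; case: Lq.
apply: (@le_trans _ _ (\int[leb]_(x in Iab c d) (q x ^+ 2)%:E)%E); last first.
  by apply: ge0_subset_integral => // x _; rewrite lee_fin sqr_ge0.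
rewrite EFinM -lebesgue_Iab// -integral_cst//.
apply: ge0_le_integral => //.
- by move=> x _; rewrite lee_fin sqr_ge0.
- exact: (measurable_funS (measurable_Iab a b) sub mq2).
- move=> x cdx; rewrite lee_fin -[q x ^+ 2]real_normK ?num_real//.
  by rewrite lerXn2r ?nnegrE//; exact: qe.
Qed.

(** If |v z| > B, continuity keeps |v| away from B on a whole interval, which forces q to be bounded
    below there and contradicts its small L2 norm. This is how L2 convergence of the truncations
    yields a sup-norm bound. *)
Lemma L2_limit_bound (v : R -> R) B : a < b -> {within D, continuous v} ->
  (forall eta, 0 < eta -> exists q, [/\ L2 q, <<q, q>> <= eta &
     forall z, D z -> `|v z| <= B + `|q z| + eta]) ->
  forall z, D z -> `|v z| <= B.
Proof.
move=> ab cv H z Dz; rewrite leNgt; apply/negP => Bv.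
(* One third is lost to the variation of v, one to eta, and the last third remains as a lower bound
   for |q|. *)
pose e := (`|v z| - B) / 3.
have e0 : 0 < e by rewrite divr_gt0// subr_gt0.
have [c [d [cd sub close]]] := within_continuous_interval ab Dz e0 cv.
have eta0 : 0 < Num.min e (e ^+ 2 * (d - c) / 2).
  by rewrite lt_min e0 divr_gt0// mulr_gt0 ?exprn_gt0// subr_gt0.
have [q [Lq q2 bnd]] := H _ eta0.
have : e ^+ 2 * (d - c) <= <<q, q>>.
  apply: inner_ge_interval => //; try exact: ltW.
  move=> x cdx; have := bnd x (sub x cdx); have := close x cdx.
  have : Num.min e (e ^+ 2 * (d - c) / 2) <= e by rewrite ge_min lexx.
  have : `|v z| <= `|v x| + `|v x - v z|.
    by rewrite -[X in `|X| <= _](subKr (v x)) ler_normB.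
  rewrite /e; set M := Num.min _ _; lra.
move=> /le_trans/(_ q2); rewrite le_min => /andP[_].
have : 0 < e ^+ 2 * (d - c) by rewrite mulr_gt0 ?exprn_gt0// subr_gt0.
set X := e ^+ 2 * _; lra.
Qed.

End L2Limit.

Lemma sqrtrD_le (R : rcfType) (x y : R) : 0 <= x -> 0 <= y ->
  Num.sqrt (x + y) <= Num.sqrt x + Num.sqrt y.
Proof.
move=> x0 y0; rewrite -(ler_sqr (x := Num.sqrt _)) ?nnegrE ?addr_ge0 ?sqrtr_ge0//.
rewrite sqr_sqrtr ?addr_ge0// sqrrD !sqr_sqrtr// -addrA lerD2l lerDr.
by rewrite mulrn_wge0// mulr_ge0 ?sqrtr_ge0.
Qed.

(** * The operator K = T^*T and the equation alpha v + K v = h *)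

Section Resolvent.
Variable R : realType.
Variables (a b C : R) (f : R -> R).
Local Notation leb := (@lebesgue_measure R).
Local Notation D := (Iab a b).
Local Notation L2 := (L2 a b).
Local Notation "<< g , h >>" := (inner a b g h).
Local Notation T := (Top a b f).
Local Notation Ts := (Tstar a b f).
Local Notation K := (TstarT a b f).
Implicit Types g h u : R -> R.
Hint Resolve measurable_Iab : core.

Hypothesis mf : measurable_fun setT f.
Hypothesis f0 : forall x, 0 <= f x.
Hypothesis intf : (\int[leb]_x (f x)%:E = 1)%E.
Hypothesis ab : a < b.
Hypothesis opC : (opnormTstar2inf a b f <= C%:E)%E.
Hypothesis contTs : forall g, L2 g -> {within D, continuous (Ts g)}.

Let Lky z : D z -> L2 (fun y => f (y - z)).
Proof. exact: L2_kernel_y opC. Qed.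

Let Lkz y : D y -> L2 (fun z => f (y - z)).
Proof. by apply: L2_kernel_z => //; exact: ltW. Qed.

Let LT g : L2 g -> L2 (T g).
Proof. exact: L2_Top. Qed.

Let LTs g : L2 g -> L2 (Ts g).
Proof. by move=> Lg; apply: L2_continuous; exact: contTs. Qed.

Let LK g : L2 g -> L2 (K g).
Proof. by move=> Lg; apply: LTs; exact: LT. Qed.

Let adj g h : L2 g -> L2 h -> <<T g, h>> = <<g, Ts h>>.
Proof. by apply: Top_adjoint => //; exact: ltW. Qed.

Lemma Tstar_le g z : L2 g -> D z -> `|Ts g z| <= C * L2norm a b g.
Proof.
move=> Lg Dz; apply: (Tstar_le_of_integrable opC) => //.
by apply: L2_mul_integrable => //; exact: Lky.
Qed.

Lemma TstarT_continuous g : L2 g -> {within D, continuous (K g)}.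
Proof. by move=> Lg; apply: contTs; exact: LT. Qed.

Lemma TstarTD g h z : L2 g -> L2 h -> D z ->
  K (fun x => g x + h x) z = K g z + K h z.
Proof.
move=> Lg Lh Dz; rewrite /TstarT !TstarE -innerDl//; try exact: LT; last exact: Lky.
by apply: eq_inner => // y Dy; rewrite !TopE innerDl//; exact: Lkz.
Qed.

Lemma TstarTZ c g z : L2 g -> D z -> K (fun x => c * g x) z = c * K g z.
Proof.
move=> Lg Dz; rewrite /TstarT !TstarE -innerZl//; try exact: LT; last exact: Lky.
by apply: eq_inner => // y Dy; rewrite !TopE innerZl//; exact: Lkz.
Qed.

Lemma eq_TstarT g h z : (forall x, D x -> g x = h x) -> K g z = K h z.
Proof.
move=> gh; apply: eq_inner => // y Dy; rewrite !TopE; exact: eq_inner.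
Qed.

Lemma TstarTB g h z : L2 g -> L2 h -> D z ->
  K (fun x => g x - h x) z = K g z - K h z.
Proof.
move=> Lg Lh Dz; rewrite -mulN1r -(TstarTZ _ Lh Dz) -(TstarTD Lg (L2Z (-1) Lh) Dz).
by apply: eq_TstarT => x _; rewrite mulN1r.
Qed.

Lemma TstarT_sum n (F : nat -> R -> R) z : (forall k, L2 (F k)) -> D z ->
  K (fun x => \sum_(k < n) F k x) z = \sum_(k < n) K (F k) z.
Proof.
move=> LF Dz; elim: n => [|n IH].
  rewrite big_ord0 (eq_TstarT (h := fun x => 0 * 0))//.
    by rewrite (TstarTZ 0 (L2_0 a b))// mul0r.
  by move=> x _; rewrite big_ord0 mul0r.
rewrite big_ord_recr/= -IH -(TstarTD (L2_sum n LF) (LF n) Dz).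
by apply: eq_TstarT => x _; rewrite big_ord_recr.
Qed.

(** By contraction T g is null as well, and T^* integrates it against a square integrable section.
    An identity in L2 thus becomes pointwise after one application of K. *)
Lemma TstarT_null g z : L2 g -> <<g, g>> = 0 -> D z -> K g z = 0.
Proof.
move=> Lg g0 Dz; have Tg0 : <<T g, T g>> = 0.
  by apply/le_anti; rewrite inner_ge0 andbT -g0; exact: Top_contraction.
by rewrite /TstarT TstarE; apply: inner_null => //; [exact: LT|exact: Lky].
Qed.

Lemma TstarT_energy g : L2 g -> <<K g, g>> = <<T g, T g>>.
Proof. by move=> Lg; rewrite innerC adj//; exact: LT. Qed.

Lemma resolvent_unique (alpha : R) g : 0 < alpha -> L2 g ->
  (forall z, D z -> alpha * g z + K g z = 0) -> forall z, D z -> g z = 0.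
Proof.
move=> al0 Lg eqn z Dz.
have g0 : <<g, g>> = 0.
  have : <<(fun x => alpha * g x + K g x), g>> = 0.
    by rewrite -(inner0l a b g); apply: eq_inner.
  rewrite innerDl//; [|exact: L2Z|exact: LK].
  rewrite innerZl// TstarT_energy//.
  have := inner_ge0 a b (T g); have := inner_ge0 a b g => g0 Tg0 H.
  have {}H : alpha * <<g, g>> <= 0 by lra.
  by apply/le_anti; rewrite g0 andbT -(pmulr_rle0 _ al0).
have := eqn z Dz; rewrite TstarT_null// addr0 => /eqP.
by rewrite mulf_eq0 gt_eqF//= => /eqP.
Qed.

(** Testing the equation with g gives alpha |g|^2 + |T g|^2 = <h, g>, and [inner_Young] with t =
    alpha cancels alpha |g|^2. *)
Lemma resolvent_energy (alpha : R) g h : 0 < alpha -> L2 g -> L2 h ->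
  (forall z, D z -> alpha * g z + K g z = h z) ->
  <<T g, T g>> <= <<h, h>> / (4 * alpha).
Proof.
move=> al0 Lg Lh eqn.
have : <<(fun x => alpha * g x + K g x), g>> = <<h, g>> by apply: eq_inner.
rewrite innerDl//; [|exact: L2Z|exact: LK].
rewrite innerZl// TstarT_energy//.
have := inner_Young al0 Lh Lg; set X := _ / _; lra.
Qed.

(** * Spectral truncation of the source condition *)

Section Spectral.
Variables (beta : R) (e : nat -> R -> R) (lam : nat -> R) (psi phi : R -> R).
Hypothesis beta0 : 0 < beta.
Hypothesis Le : forall k, L2 (e k).
Hypothesis orth : forall i j, <<e i, e j>> = (i == j)%:R.
Hypothesis lam0 : forall k, 0 <= lam k.
Hypothesis Kspec : forall g, L2 g ->
  L2lim a b (fun N x => \sum_(k < N) lam k * <<g, e k>> * e k x) (K g).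
Hypothesis Lpsi : L2 psi.
Hypothesis psiC : L2norm a b psi <= C.
Hypothesis cphi : {within D, continuous phi}.
Hypothesis phi_fpow :
  L2lim a b (fun N x => \sum_(k < N) (lam k `^ beta) * <<Ts psi, e k>> * e k x) phi.

(** The spectral series of K at e_k reduces by orthonormality to lam_k e_k, so this residue is null;
    it may still be nonzero at individual points. *)
Let res k x := K (e k) x - lam k * e k x.

Let Lr k : L2 (res k).
Proof. by apply: L2B; [exact: LK|exact: L2Z]. Qed.

Let r_null k : <<res k, res k>> = 0.
Proof.
have h := Kspec (Le k).
have {}h : (fun N : nat => L2norm a b (fun x => lam k * e k x - K (e k) x)) @ \oo --> (0 : R).
  apply: cvg_trans h; apply: near_eq_cvg; near=> N.
  have kN : (k < N)%N by near: N; exact: nbhs_infty_gt.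
  congr (L2norm a b _); apply/funext => x; congr (_ - _).
  rewrite (bigD1 (Ordinal kN))//= orth eqxx mulr1 big1 ?addr0// => i ik.
  by rewrite orth eq_sym (_ : _ == _ = false) ?mulr0 ?mul0r//; exact/negbTE.
have n0 : L2norm a b (fun x => lam k * e k x - K (e k) x) = 0.
  by apply: (cvg_unique _ (cvg_cst _) h); exact: norm_hausdorff.
have : <<(fun x => lam k * e k x - K (e k) x), (fun x => lam k * e k x - K (e k) x)>> = 0.
  by rewrite -sqr_L2norm n0 expr0n.
move=> <-; apply: eq_Rintegral => x _; rewrite /res; ring.
Unshelve. all: by end_near. Qed.

(** K annihilates the residue at every point, so K e_k is a pointwise eigenfunction on [a, b] where
    e_k is one only in L2. *)
Let KK k z : D z -> K (K (e k)) z = lam k * K (e k) z.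
Proof.
move=> Dz; have := TstarT_null (Lr k) (r_null k) Dz.
rewrite TstarTB//; [|exact: LK|exact: L2Z].
by rewrite TstarTZ// => /eqP; rewrite subr_eq0 => /eqP.
Qed.

Lemma TstarT_eigenvalue i j : <<T (e i), T (e j)>> = lam j * (i == j)%:R.
Proof.
rewrite adj//; last exact: LT.
have -> : <<e i, Ts (T (e j))>> = <<e i, res j>> + <<e i, (fun x => lam j * e j x)>>.
  rewrite -innerDr//; last exact: L2Z.
  by apply: eq_inner => // x _; rewrite /res subrK.
by rewrite innerC inner_null// add0r innerZr// orth.
Qed.

Lemma TstarT_eigenvalue_le1 k : lam k <= 1.
Proof.
have := Top_contraction mf f0 intf (Le k).
by rewrite TstarT_eigenvalue orth eqxx mulr1.
Qed.

(** [S] is T^* applied to [G] at every point of [a, b], so its sup norm is at most C times the L2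
    norm of [G], and that norm is explicit because the T e_k are orthogonal. *)
Let G (w : nat -> R) N x := \sum_(k < N) w k * T (e k) x.
Let S (w : nat -> R) N x := \sum_(k < N) w k * K (e k) x.

Let LG w N : L2 (G w N).
Proof. by apply: (@L2_sum _ _ _ _ (fun k x => w k * T (e k) x)) => k; apply: L2Z; exact: LT. Qed.

Let LS w N : L2 (S w N).
Proof. by apply: (@L2_sum _ _ _ _ (fun k x => w k * K (e k) x)) => k; apply: L2Z; exact: LK. Qed.

Let SG w N z : D z -> S w N z = Ts (G w N) z.
Proof.
move=> Dz; rewrite TstarE (@inner_suml _ _ _ _ (fun k x => w k * T (e k) x)).
- by apply: eq_bigr => k _; rewrite innerZl//; [exact: LT|exact: Lky].
- by move=> k; apply: L2Z; exact: LT.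
- exact: Lky.
Qed.

Let KS w N z : D z -> K (S w N) z = \sum_(k < N) w k * (lam k * K (e k) z).
Proof.
move=> Dz; rewrite (@TstarT_sum _ (fun k x => w k * K (e k) x))//; last first.
  by move=> k; apply: L2Z; exact: LK.
by apply: eq_bigr => k _; rewrite TstarTZ ?KK//; exact: LK.
Qed.

Let GG w N : <<G w N, G w N>> = \sum_(k < N) w k ^+ 2 * lam k.
Proof.
have LwT k : L2 (fun x => w k * T (e k) x) by apply: L2Z; exact: LT.
rewrite {1}/G (@inner_suml _ _ _ _ (fun k x => w k * T (e k) x))//.
apply: eq_bigr => k _.
rewrite /G (@inner_sumr _ _ _ _ (fun k x => w k * T (e k) x))//.
rewrite (bigD1 k)//= big1 ?addr0 => [|i ik].
  rewrite innerZl ?innerZr//; try exact: LT.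
  by rewrite TstarT_eigenvalue eqxx mulr1 mulrA -expr2.
rewrite innerZl ?innerZr//; try exact: LT.
by rewrite TstarT_eigenvalue (_ : _ == _ = false) ?mulr0// eq_sym; apply/negbTE.
Qed.

Let c k := <<Ts psi, e k>>.

Let cE k : c k = <<psi, T (e k)>>.
Proof. by rewrite /c innerC -adj// innerC. Qed.

Lemma Bessel_singular N : \sum_(k < N) (lam k)^-1 * c k ^+ 2 <= <<psi, psi>>.
Proof.
pose w k := (lam k)^-1 * c k.
have := inner_ge0 a b (fun x => psi x - G w N x).
rewrite innerBl ?innerBr//; try exact: L2B.
rewrite (innerC _ _ (G w N) psi) GG.
have -> : <<psi, G w N>> = \sum_(k < N) (lam k)^-1 * c k ^+ 2.
  rewrite /G (@inner_sumr _ _ _ _ (fun k x => w k * T (e k) x))//; last first.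
    by move=> k; apply: L2Z; exact: LT.
  apply: eq_bigr => k _; rewrite innerZr//; last exact: LT.
  by rewrite -cE /w -mulrA -expr2.
have -> : \sum_(k < N) w k ^+ 2 * lam k = \sum_(k < N) (lam k)^-1 * c k ^+ 2.
  apply: eq_bigr => k _; rewrite /w.
  (* The inverse of 0 is 0, so the sum effectively runs over the positive eigenvalues. *)
  have [->|l0] := eqVneq (lam k) 0; first by rewrite invr0 mulr0 mul0r.
  by field.
set X := \sum_(k < N) _; lra.
Qed.

(** In L2 this is the partial sum of lam_k^beta c_k e_k: the factor 1 / lam_k pays for replacing e_k
    by K e_k. *)
Let phiN N := S (fun k => lam k `^ beta * (lam k)^-1 * c k) N.

Let phiN_err N : <<(fun x => phi x - phiN N x), (fun x => phi x - phiN N x)>> <=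
  2 * L2norm a b (fun x => \sum_(k < N) (lam k `^ beta) * c k * e k x - phi x) ^+ 2.
Proof.
have Lphi : L2 phi by exact: L2_continuous.
pose p k x := (lam k `^ beta * (lam k)^-1 * c k) * res k x.
pose u k x := (lam k `^ beta) * c k * e k x.
have Lp k : L2 (p k) by exact: L2Z.
have Lu k : L2 (u k) by exact: L2Z.
have LsP : L2 (fun x => \sum_(k < N) p k x) by exact: L2_sum.
have LsU : L2 (fun x => \sum_(k < N) u k x) by exact: L2_sum.
have p_null : <<(fun x => \sum_(k < N) p k x), (fun x => \sum_(k < N) p k x)>> = 0.
  rewrite inner_suml// big1// => k _; rewrite inner_null//.
  by rewrite innerZl ?innerZr// r_null !mulr0.
have := inner_sqrD_le LsP (L2B LsU Lphi).
rewrite p_null mulr0 add0r sqr_L2norm => h.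
apply: le_trans h; rewrite le_eqVlt; apply/orP; left; apply/eqP.
apply: eq_Rintegral => x _.
suff -> : phi x - phiN N x = - (\sum_(k < N) p k x + (\sum_(k < N) u k x - phi x)).
  by ring.
rewrite addrA -big_split/= opprB; congr (_ - _); apply: eq_bigr => k _.
rewrite /p /u /res; have [->|l0] := eqVneq (lam k) 0; last by field.
(* No term is lost at lam_k = 0, because 0^beta = 0 for beta > 0. *)
by rewrite powR0 ?gt_eqF//; ring.
Qed.

(* S w N is the solution v_N for the right-hand side -alpha phi_N, and the
   remainder nu = v - v_N has right-hand side xi - alpha (phi - phi_N). *)
Lemma resolvent_error_bound (alpha Sb X : R) (xi v : R -> R) : 0 < alpha ->
  (forall k, alpha * lam k `^ beta / (alpha + lam k) <= Sb) ->
  {within D, continuous xi} -> (forall z, D z -> `|xi z| <= X) ->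
  L2 v -> (forall z, D z -> alpha * v z + K v z = xi z - alpha * phi z) ->
  forall z, D z -> `|v z| <= C ^+ 2 * Sb +
    (X + C * Num.sqrt (<<xi, xi>> / (2 * alpha))) / alpha.
Proof.
move=> al0 SbP cxi xiX Lv eqn.
have Lphi : L2 phi by exact: L2_continuous.
have Lxi : L2 xi by exact: L2_continuous.
have C0 : 0 <= C := le_trans (L2norm_ge0 a b psi) psiC.
have Sb0 : 0 <= Sb.
  apply: le_trans (SbP 0%N); rewrite divr_ge0 ?mulr_ge0 ?powR_ge0 ?addr_ge0//; exact: ltW.
(* A resolvent solution is given only as an L2 function; its equation expresses it through the
   continuous xi, phi and K v. *)
have cv : {within D, continuous v}.
  have h : {within D, continuous (fun z => alpha^-1 * (xi z - alpha * phi z - K v z))}.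
    move=> z; apply: cvgM; first exact: cvg_cst.
    apply: cvgB; last exact: TstarT_continuous.
    by apply: cvgB; [exact: cxi|apply: cvgM; [exact: cvg_cst|exact: cphi]].
  apply: subspace_eq_continuous h => z /[!inE] Dz.
  change (alpha^-1 * (xi z - alpha * phi z - K v z) = v z).
  by rewrite -eqn// addrK mulrA mulVf ?mul1r// gt_eqF.
apply: (L2_limit_bound ab cv) => eta eta0.
(* As |q|^2 <= 2 k1, the first entry makes |q|^2 <= eta, and the second makes the contribution of
   alpha q to K nu at most alpha eta. The denominator C + 1 covers C = 0. *)
pose k1 := Num.min (eta / 2) ((eta * Num.sqrt (2 * alpha) / (C + 1)) ^+ 2 / 2).
have k10 : 0 < k1.
  rewrite lt_min !divr_gt0//= ?exprn_gt0// divr_gt0 ?mulr_gt0 ?sqrtr_gt0 ?mulr_gt0//.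
  by rewrite ltr_wpDl.
have [N errN] : exists N, L2norm a b (fun x => \sum_(k < N) (lam k `^ beta) * c k * e k x - phi x) ^+ 2 <= k1.
  have sk : 0 < Num.sqrt k1 by rewrite sqrtr_gt0.
  move/cvgrPdist_le : phi_fpow => /(_ _ sk)[N _ /(_ N (leqnn N))].
  rewrite sub0r normrN ger0_norm ?L2norm_ge0// => h; exists N.
  by rewrite -(sqr_sqrtr (ltW k10)) lerXn2r ?nnegrE ?L2norm_ge0 ?sqrtr_ge0.
pose q x := phi x - phiN N x.
have Lq : L2 q by apply: L2B => //; exact: LS.
have q2 : <<q, q>> <= 2 * k1.
  by apply: le_trans (phiN_err N) _; rewrite ler_pM2l.
(* By the pointwise eigenrelation the truncated equation is diagonal in K e_k: (alpha + lam_k) w_k =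
   - alpha lam_k^beta c_k / lam_k. *)
pose w k := - (alpha * lam k `^ beta / (alpha + lam k) * (lam k)^-1 * c k).
pose vN := S w N.
have LvN : L2 vN by exact: LS.
have vNb z : D z -> `|vN z| <= C ^+ 2 * Sb.
  move=> Dz; rewrite /vN SG//; apply: le_trans (Tstar_le (LG w N) Dz) _.
  rewrite expr2 -mulrA ler_wpM2l//.
  rewrite -[leRHS]ger0_norm ?mulr_ge0// -[leLHS]ger0_norm ?L2norm_ge0//.
  rewrite -ler_sqr ?nnegrE// ?real_normK ?num_real//.
  rewrite sqr_L2norm GG exprMn.
  apply: (@le_trans _ _ (Sb ^+ 2 * \sum_(k < N) (lam k)^-1 * c k ^+ 2)).
    rewrite mulr_sumr; apply: ler_sum => k _.
    have [l0|l0] := eqVneq (lam k) 0.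
      by rewrite l0 invr0 mulr0 mul0r mulr0.
    set m := alpha * lam k `^ beta / (alpha + lam k).
    have -> : w k ^+ 2 * lam k = m ^+ 2 * ((lam k)^-1 * c k ^+ 2).
      by rewrite /w -/m; field.
    apply: ler_wpM2r; first by apply: mulr_ge0; rewrite ?invr_ge0 ?sqr_ge0.
    rewrite lerXn2r ?nnegrE ?SbP//.
    by rewrite divr_ge0 ?mulr_ge0 ?powR_ge0 ?addr_ge0//; exact: ltW.
  rewrite [leRHS]mulrC ler_wpM2l ?sqr_ge0//.
  apply: le_trans (Bessel_singular N) _; rewrite -sqr_L2norm.
  by rewrite lerXn2r ?nnegrE ?L2norm_ge0.
have eqnN z : D z -> alpha * vN z + K vN z = - (alpha * phiN N z).
  move=> Dz; rewrite /vN KS// /phiN /S !mulr_sumr -sumrN -big_split/=.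
  apply: eq_bigr => k _; rewrite /w.
  have alk : alpha + lam k != 0 by rewrite gt_eqF// ltr_pwDl.
  have [->|l0] := eqVneq (lam k) 0; last by field; apply/andP.
  by rewrite invr0; ring.
pose nu x := v x - vN x.
have Lnu : L2 nu by exact: L2B.
pose dl x := alpha * q x.
have Ldl : L2 dl by exact: L2Z.
have eqnu z : D z -> alpha * nu z + K nu z = xi z - dl z.
  move=> Dz; rewrite /nu TstarTB// /dl /q.
  have := eqn z Dz; have := eqnN z Dz.
  rewrite !mulrBr; lra.
exists q; split => //.
  by apply: le_trans q2 _; rewrite mulrC -ler_pdivlMr// ge_min lexx.
move=> z Dz.
(* The energy estimate has 4 alpha in the denominator; splitting |xi - dl|^2 into twice the squares
   turns it into 2 alpha. *)
have En : <<T nu, T nu>> <= <<xi, xi>> / (2 * alpha) + <<dl, dl>> / (2 * alpha).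
  apply: le_trans (resolvent_energy al0 Lnu (L2B Lxi Ldl) eqnu) _.
  have h : <<(fun x => xi x - dl x), (fun x => xi x - dl x)>> <= 2 * <<xi, xi>> + 2 * <<dl, dl>>.
    have := inner_sqrD_le Lxi (L2Z (-1) Ldl).
    rewrite (innerZl _ Ldl (L2Z (-1) Ldl)) (innerZr _ Ldl Ldl).
    rewrite (_ : -1 * (-1 * _) = <<dl, dl>>); last by ring.
    apply: le_trans; rewrite le_eqVlt; apply/orP; left; apply/eqP.
    by apply: eq_Rintegral => x _; ring.
  rewrite -mulrDl; apply: (@le_trans _ _ ((2 * <<xi, xi>> + 2 * <<dl, dl>>) / (4 * alpha))).
    by rewrite ler_wpM2r// invr_ge0 mulr_ge0// ltW.
  rewrite le_eqVlt; apply/orP; left; apply/eqP; field.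
  by rewrite gt_eqF.
have al2 : 0 < 2 * alpha by rewrite mulr_gt0.
have Knu : `|K nu z| <= C * (Num.sqrt (<<xi, xi>> / (2 * alpha)) + Num.sqrt (<<dl, dl>> / (2 * alpha))).
  apply: le_trans (Tstar_le (LT Lnu) Dz) _; rewrite ler_wpM2l// L2normE.
  apply: le_trans (sqrtrD_le _ _); last 2 first.
  - by rewrite divr_ge0 ?inner_ge0// ltW.
  - by rewrite divr_ge0 ?inner_ge0// ltW.
  by rewrite ler_sqrt// (le_trans (inner_ge0 a b (T nu))).
have dlb : C * Num.sqrt (<<dl, dl>> / (2 * alpha)) <= alpha * eta.
  have -> : <<dl, dl>> = alpha ^+ 2 * <<q, q>>.
    by rewrite innerZl ?innerZr// mulrA -expr2.
  rewrite -mulrA sqrtrM ?sqr_ge0// sqrtr_sqr gtr0_norm// mulrCA ler_wpM2l ?(ltW al0)//.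
  have h : <<q, q>> <= (eta * Num.sqrt (2 * alpha) / (C + 1)) ^+ 2.
    by apply: le_trans q2 _; rewrite mulrC -ler_pdivlMr// ge_min lexx orbT.
  have C1 : 0 < C + 1 by rewrite ltr_wpDl.
  have s2 : 0 < Num.sqrt (2 * alpha) by rewrite sqrtr_gt0.
  apply: (@le_trans _ _ (C * (eta / (C + 1)))).
    rewrite ler_wpM2l// -[leRHS]ger0_norm; last by rewrite divr_ge0// ltW.
    rewrite -sqrtr_sqr ler_sqrt ?sqr_ge0// ler_pdivrMr//.
    apply: le_trans h _; rewrite le_eqVlt; apply/orP; left; apply/eqP.
    rewrite -[X in _ = _ * X]sqr_sqrtr ?(ltW al2)//; field.
    by rewrite gt_eqF.
  rewrite mulrCA ler_piMr ?(ltW eta0)// ler_pdivrMr// mul1r lerDl//.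
(* The energy bound makes K nu uniformly small, and the equation then yields nu itself. The term dl
   / alpha = q is controlled only in L2 and is the one left to [L2_limit_bound]. *)
have nuE : nu z = alpha^-1 * (xi z - dl z - K nu z).
  by have := eqnu z Dz => <-; rewrite addrK mulrA mulVf ?mul1r// gt_eqF.
have nub : `|nu z| <= (X + C * Num.sqrt (<<xi, xi>> / (2 * alpha))) / alpha + `|q z| + eta.
  rewrite nuE normrM gtr0_norm ?invr_gt0// mulrC ler_pdivrMr//.
  move: Knu; rewrite mulrDr; set s1 := C * Num.sqrt (<<xi, xi>> / _) => Knu.
  have -> : ((X + s1) / alpha + `|q z| + eta) * alpha = X + s1 + `|q z| * alpha + eta * alpha.
    by field; rewrite gt_eqF.
  have h1 : `|xi z - dl z - K nu z| <= `|xi z| + `|dl z| + `|K nu z|.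
    by apply: le_trans (ler_normB _ _) _; rewrite lerD2r ler_normB.
  have h2 := xiX z Dz.
  have h3 : `|dl z| = alpha * `|q z| by rewrite normrM gtr0_norm.
  move: Knu dlb h1 h2; rewrite h3.
  set s2 := C * Num.sqrt (<<dl, dl>> / _); lra.
have : `|v z| <= `|vN z| + `|nu z|.
  by rewrite -[X in `|X| <= _](subrK (vN z)) addrC ler_normD.
have := vNb z Dz; move: nub; set s1 := _ / alpha; set s2 := C ^+ 2 * Sb; lra.
Qed.

End Spectral.
End Resolvent.

(** * The Tikhonov filter and error bounds on the source class *)

Section SourceClass.
Variable R : realType.
Implicit Types (a b beta C M alpha : R) (f phi : R -> R).

(** Otherwise [a, b] has measure 0, every L2 norm vanishes, and T has norm 0, against 1 <= C |T|. *)
Lemma classF_lt a b beta C M phi f : 0 < C -> classF a b beta C M phi f -> a < b.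
Proof.
move=> C0 [_ _ _ h _]; rewrite ltNge; apply/negP => ba.
have n0 g : L2norm a b g = 0.
  rewrite /L2norm (_ : Rintegral _ _ _ = 0) ?sqrtr0//.
  move: ba; rewrite le_eqVlt => /predU1P[->|ba].
    by rewrite /Iab set_itv1 Rintegral_set1.
  by rewrite /Iab set_itv_ge ?Rintegral_set0// bnd_simp -ltNge.
have : (opnormT a b f <= 0)%E.
  by apply: ge_ereal_sup => _ [g _ <-]; rewrite n0.
rewrite -(pmule_rle0 _ (_ : (0 < C%:E)%E)) ?lte_fin// => /(le_trans h).
by rewrite lee_fin ler10.
Qed.

Lemma classF_C_ge1 a b beta C M phi f : 0 < C -> is_density f ->
  classF a b beta C M phi f -> 1 <= C.
Proof.
move=> C0 [mf [f0 intf]] FF; have ab := classF_lt C0 FF.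
case: FF => _ _ opC h _.
have : (opnormT a b f <= 1)%E.
  apply: ge_ereal_sup => _ [g [Lg g1] <-]; rewrite lee_fin.
  apply: le_trans g1; rewrite !L2normE ler_sqrt ?inner_ge0//.
  by apply: Top_contraction => //; exact: ltW.
rewrite -(lee_pmul2l (_ : C%:E \is a fin_num) (_ : (0 < C%:E)%E)) ?lte_fin// mule1.
by move=> /(le_trans h); rewrite lee_fin.
Qed.

(* For beta < 1 the maximum over lam of alpha lam^beta / (alpha + lam) is
   beta^beta (1 - beta)^(1 - beta) alpha^beta, by weighted AM-GM applied to
   lam / beta and alpha / (1 - beta). *)
Lemma Tikhonov_filter_bound beta C alpha (lam : R) : 0 < beta -> 0 < alpha ->
  0 <= lam <= 1 -> 1 <= C ->
  alpha * lam `^ beta / (alpha + lam) <=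
  ((if (0 < beta) && (beta < 1) then beta `^ beta * (1 - beta) `^ (1 - beta) else 0)
   + (if 1 <= beta then C `^ (2 * (beta - 1)) else 0)) * alpha `^ Num.min beta 1.
Proof.
move=> b0 al0 /andP[l0 l1] C1.
have all0 : 0 < alpha + lam by rewrite ltr_pwDl.
rewrite b0 ler_pdivrMr//=; have [b1|b1] := ltP beta 1; last first.
  rewrite add0r powRr1 ?(ltW al0)// mulrAC [leRHS]mulrC ler_wpM2l ?(ltW al0)//.
  (* For beta >= 1 the filter is at most alpha, since lam^beta <= lam when lam <= 1. The constant
     C^(2 (beta - 1)) only has to be at least 1, which C >= 1 provides. *)
  have h1 : 1 <= C `^ (2 * (beta - 1)).
    by rewrite -[leLHS](powRr0 C) ler_powR//; lra.
  have h2 : lam `^ beta <= lam.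
    move: l0; rewrite le_eqVlt => /predU1P[<-|l0]; first by rewrite powR0// gt_eqF.
    by rewrite ge1r_powR// l0.
  apply: le_trans h2 _; apply: le_trans (_ : alpha + lam <= _).
    by rewrite lerDr ltW.
  by rewrite ler_peMl// ltW.
rewrite addr0; have b1' : 0 < 1 - beta by rewrite subr_gt0.
pose A := (lam / beta) `^ beta; pose B := (alpha / (1 - beta)) `^ (1 - beta).
have lb0 : 0 <= lam / beta by rewrite divr_ge0// ltW.
have ab0 : 0 <= alpha / (1 - beta) by rewrite divr_ge0// ltW.
have AB : A * B <= lam + alpha.
  have := @conjugate_powR R A B beta^-1 (1 - beta)^-1 (powR_ge0 _ _) (powR_ge0 _ _).
  rewrite !invr_gt0 !invrK => /(_ b0 b1').
  rewrite addrC subrK => /(_ erefl).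
  rewrite /A /B -!powRrM !divff ?gt_eqF// !powRr1// !divfK// gt_eqF//.
have lE : lam `^ beta = A * beta `^ beta.
  by rewrite /A -powRM ?(ltW b0)// divfK// gt_eqF.
have aE : alpha = alpha `^ beta * (B * (1 - beta) `^ (1 - beta)).
  rewrite /B -powRM ?(ltW b1')// divfK ?gt_eqF// -powRD; last by rewrite (gt_eqF al0) implybT.
  by rewrite addrC subrK powRr1// ltW.
rewrite {1}aE lE.
have -> : alpha `^ beta * (B * (1 - beta) `^ (1 - beta)) * (A * beta `^ beta) =
  (beta `^ beta * (1 - beta) `^ (1 - beta) * alpha `^ beta) * (A * B) by ring.
rewrite ler_wpM2l ?mulr_ge0 ?powR_ge0//.
by rewrite addrC.
Qed.

(** Bias and noise in one estimate: xi = 0 leaves the bias term alone, and the empirical error as xi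
    adds the stochastic term. *)
Lemma classF_error_bound a b beta C M phi f alpha (X : R) (xi v : R -> R) :
  0 < beta -> 0 < C -> 0 < alpha -> is_density f -> classF a b beta C M phi f ->
  {within Iab a b, continuous xi} -> (forall z, Iab a b z -> `|xi z| <= X) ->
  L2 a b v ->
  (forall z, Iab a b z -> alpha * v z + TstarT a b f v z = xi z - alpha * phi z) ->
  forall z, Iab a b z -> `|v z| <= Rconst beta C * alpha `^ Num.min beta 1 +
    (X + C * Num.sqrt (inner a b xi xi / (2 * alpha))) / alpha.
Proof.
move=> b0 C0 al0 df FF cxi xiX Lv eqn z Dz.
have ab := classF_lt C0 FF; have C1 := classF_C_ge1 C0 df FF.
case: df => mf [f0 intf].
case: FF => -[cphi _] cTs opC _ [psi [Lpsi psiC [e [lam [[Le orth lam0 Ks] fp]]]]].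
rewrite /Rconst -mulrA.
apply: (@resolvent_error_bound _ a b C f mf f0 intf ab opC cTs beta e lam psi phi) => //.
move=> k; apply: Tikhonov_filter_bound => //; rewrite lam0/=.
exact: (@TstarT_eigenvalue_le1 _ a b C f mf f0 intf ab opC cTs e lam).
Qed.

Lemma deterministic_bound a b beta C M phi f alpha (n : nat) (y : nat -> R)
    (phihat nu : R -> R) (h : nat -> R -> R) :
  0 < beta -> 0 < C -> is_density f -> classF a b beta C M phi f ->
  0 < alpha -> (0 < n)%N ->
  is_resolvent a b f alpha (hatTstar_r f n y) phihat ->
  is_resolvent a b f alpha
    (fun z => hatTstar_r f n y z - Tstar a b f (Top a b f phi) z) nu ->
  (forall i, (i < n)%N -> is_resolvent a b f alpha (X2 a b f phi (y i)) (h i)) ->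
  (supnorm a b (fun z => (phihat z - phi z)%R)
     <= supnorm a b nu + (Rconst beta C * alpha `^ Num.min beta 1)%R%:E)%E
  /\ (forall z, Iab a b z -> nu z = n%:R^-1 * \sum_(i < n) h i z).
Proof.
move=> b0 C0 df FF al0 n0 [Lph eph] [Lnu enu] hP.
have ab := classF_lt C0 FF.
have [mf [f0 intf]] := df.
have [[cphi _] cTs opC _ _] := FF.
have Lphi : L2 a b phi by exact: L2_continuous.
have KB := TstarTB mf f0 intf ab opC; have KZ := TstarTZ mf f0 intf ab opC.
have KS := TstarT_sum mf f0 intf ab opC.
split.
(* Subtracting nu removes the noise: v solves the equation with xi = 0, so only the bias remains and
   the constant R is exact. *)
- pose v x := phihat x - nu x - phi x.
  have Lv : L2 a b v by apply: L2B => //; exact: L2B.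
  have eqn z : Iab a b z -> alpha * v z + TstarT a b f v z = 0 - alpha * phi z.
    move=> Dz; rewrite /v KB//; last exact: L2B.
    rewrite KB// !mulrBr; have := eph z Dz; have := enu z Dz.
    rewrite -/(TstarT a b f phi z).
    move: (TstarT a b f phihat z) (TstarT a b f nu z) (TstarT a b f phi z) => k1 k2 k3; lra.
  have vb z : Iab a b z -> `|v z| <= Rconst beta C * alpha `^ Num.min beta 1.
    move=> Dz.
    have := classF_error_bound b0 C0 al0 df FF (xi := fun=> 0) (X := 0) _ _ Lv eqn Dz.
    rewrite inner0l mul0r sqrtr0 mulr0 addr0 mul0r addr0; apply.
    - by apply: continuous_subspaceT => x; exact: cvg_cst.
    - by move=> x _; rewrite normr0.
  apply: ge_ereal_sup => _ [z Dz <-].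
  have -> : phihat z - phi z = nu z + v z by rewrite /v; ring.
  apply: (@le_trans _ _ (`|nu z|%:E + `|v z|%:E)%E).
    by rewrite -EFinD lee_fin ler_normD.
  apply: leeD; last by rewrite lee_fin vb.
  by apply: ereal_sup_ubound; exists z.
(* Only the indices below n carry a hypothesis on h; 0 elsewhere gives a sequence of L2 functions.
   The formula for nu then follows from uniqueness of the resolvent solution. *)
- pose hh k := if (k < n)%N then h k else fun=> 0.
  have hhE (i : 'I_n) : hh i = h i by rewrite /hh ltn_ord.
  have Lhh k : L2 a b (hh k).
    by rewrite /hh; case: ifP => [/hP[]//|_]; exact: L2_0.
  pose S x := \sum_(i < n) hh i x.
  have LS : L2 a b S by exact: L2_sum.
  pose g x := nu x - n%:R^-1 * S x.
  have Lg : L2 a b g by apply: L2B => //; exact: L2Z.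
  have eqn z : Iab a b z -> alpha * g z + TstarT a b f g z = 0.
    move=> Dz; rewrite /g KB//; last exact: L2Z.
    rewrite KZ// KS//.
    have -> : alpha * (nu z - n%:R^-1 * S z) +
      (TstarT a b f nu z - n%:R^-1 * \sum_(k < n) TstarT a b f (hh k) z) =
      (alpha * nu z + TstarT a b f nu z) -
      n%:R^-1 * \sum_(k < n) (alpha * hh k z + TstarT a b f (hh k) z).
      by rewrite big_split/= -mulr_sumr /S; ring.
    rewrite enu//.
    under eq_bigr => k _ do rewrite hhE (hP k (ltn_ord k)).2//.
    rewrite /hatTstar_r /X2 sumrB sumr_const card_ord -mulr_natl; field.
    by rewrite pnatr_eq0 -lt0n.
  move=> z Dz; have := resolvent_unique mf f0 intf ab opC cTs al0 Lg eqn Dz.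
  move/eqP; rewrite subr_eq0 => /eqP ->; congr (_ * _).
  by apply: eq_bigr => k _; rewrite hhE.
Qed.

End SourceClass.

(** * Product moments of an i.i.d. sample *)

Section Independence.
Variable R : realType.
Variables (d : measure_display) (Omega : measurableType d) (P : probability Omega R).
Variables (Y : nat -> Omega -> R) (r : R -> R).
Local Notation leb := (@lebesgue_measure R).
Hypothesis mr : measurable_fun setT r.
Hypothesis r0 : forall x, 0 <= r x.
Hypothesis iid : iid_sample P Y r.

Let mY i : measurable_fun setT (Y i). Proof. by case: iid. Qed.

Let p (B : set R) : R := fine (\int[leb]_(y in B) (r y)%:E)%E.

Let pE B : measurable B -> (\int[leb]_(y in B) (r y)%:E = (p B)%:E)%E.
Proof.
move=> mB; rewrite /p fineK//; have [_ _ law] := iid; rewrite -(law 0%N)//.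
by apply: fin_num_measure; rewrite -[X in measurable X]setTI; exact: mY.
Qed.

Lemma iid_density_integral1 : (\int[leb]_y (r y)%:E = 1)%E.
Proof.
have [_ _ law] := iid; rewrite -(law 0%N)// preimage_setT; exact: probability_setT.
Qed.

(* Induction on m, replacing one indicator at a time by the function g: as a
   function of the m-th set both sides are measures. *)
Lemma iid_prod_mixed (g : R -> R) (c : R) n m (B : nat -> set R) :
  measurable_fun setT g -> (forall x, 0 <= g x) ->
  (\int[leb]_y (r y * g y)%:E = c%:E)%E -> (m <= n)%N ->
  (forall i, measurable (B i)) ->
  (\int[P]_w (\prod_(i < n) (if (i < m)%N then g (Y i w) else \1_(B i) (Y i w)))%:E =
   (\prod_(i < n) (if (i < m)%N then c else p (B i)))%:E)%E.
Proof.
move=> mg g0 gc; elim: m B => [|m IH] B mn mB.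
  have mcap : measurable (\bigcap_(i in `I_n) (Y i @^-1` B i)).
    apply: bigcap_measurableType => // i _.
    by rewrite -[X in measurable X]setTI; exact: mY.
  transitivity (P (\bigcap_(i in `I_n) (Y i @^-1` B i))).
    rewrite -[X in P X]setIT -integral_indic//.
    apply: eq_integral => w _; congr EFin; rewrite indicE.
    have [/set_mem h|/negP h] := boolP (w \in _).
      by rewrite big1// => i _; rewrite /= indicE mem_set//; exact: (h i (ltn_ord i)).
    apply/eqP; rewrite prodf_seq_eq0; apply/hasP.
    have : ~ (forall i : 'I_n, B i (Y i w)).
      by move=> h'; apply: h; apply/mem_set => i /= ni; exact: (h' (Ordinal ni)).
    move=> /existsNP[i Bi]; exists i; first by rewrite mem_index_enum.
    by rewrite /= indicE memNset.
  have [_ ind law] := iid; rewrite ind//= -prodEFin.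
  by apply: eq_bigr => i _; rewrite (law _ _ (mB i)) (pE (mB i)).
pose i0 := Ordinal mn.
pose V w := \prod_(i < n | i != i0) (if (i < m)%N then g (Y i w) else \1_(B i) (Y i w)).
pose Q := \prod_(i < n | i != i0) (if (i < m)%N then c else p (B i)).
have c0 : 0 <= c.
  by rewrite -lee_fin -gc integral_ge0// => y _; rewrite lee_fin mulr_ge0.
have p0 A : 0 <= p A by rewrite fine_ge0// integral_ge0// => y _; rewrite lee_fin.
have V0 w : 0 <= V w.
  by apply: prodr_ge0 => i _; case: ifP => // _; rewrite indicE.
have Q0 : 0 <= Q by apply: prodr_ge0 => i _; case: ifP.
have mV : measurable_fun setT V.
  rewrite /V; under eq_fun do rewrite -big_filter.
  apply: measurable_prod => i _; case: (i < m)%N.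
    exact: measurableT_comp.
  by apply: measurableT_comp => //; exact: measurable_indic.
have splitV w : \prod_(i < n) (if (i < m.+1)%N then g (Y i w) else \1_(B i) (Y i w)) = V w * g (Y m w).
  rewrite (bigD1 i0)//= ltnSn mulrC; congr (_ * _).
  apply: eq_bigr => i ii0; rewrite ltnS leq_eqVlt (_ : (i == m :> nat) = false)//.
  by apply/negbTE; apply: contra ii0 => /eqP im; apply/eqP; exact: val_inj.
have -> : (\prod_(i < n) (if (i < m.+1)%N then c else p (B i))) = Q * c.
  rewrite (bigD1 i0)//= ltnSn mulrC; congr (_ * _).
  apply: eq_bigr => i ii0; rewrite ltnS leq_eqVlt (_ : (i == m :> nat) = false)//.
  by apply/negbTE; apply: contra ii0 => /eqP im; apply/eqP; exact: val_inj.
transitivity (\int[P]_w (V w * g (Y m w))%:E)%E.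
  by apply: eq_integral => w _; rewrite splitV.
(* The weight V holds the factors other than the m-th. The induction hypothesis, with an arbitrary
   m-th set, says that the image under Y m of V dP has density Q r. *)
rewrite (@eq_weighted_integral _ _ _ _ _ P leb V (Y m) (fun y => Q * r y) g)//.
- under eq_integral do rewrite -mulrA EFinM.
  rewrite ge0_integralZl ?gc//.
  + by apply/measurable_EFinP; exact: measurable_funM.
  + by move=> y _; rewrite lee_fin mulr_ge0.
- exact: mY.
- exact: measurable_funM.
- by move=> y; rewrite mulr_ge0.
- move=> A mA; pose B' (i : nat) : set R := if i == m then A else B i.
  have mB' i : measurable (B' i) by rewrite /B'; case: (i == m); [exact: mA|exact: mB].
  have QE : \prod_(i < n) (if (i < m)%N then c else p (B' i)) = Q * p A.
    rewrite (bigD1 i0)//= ltnn /B' eqxx mulrC; congr (_ * _).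
    apply: eq_bigr => i ii0; rewrite (_ : (i == m :> nat) = false)//.
    by apply/negbTE; apply: contra ii0 => /eqP im; apply/eqP; exact: val_inj.
  have WE w : \prod_(i < n) (if (i < m)%N then g (Y i w) else \1_(B' i) (Y i w)) =
      V w * \1_A (Y m w).
    rewrite (bigD1 i0)//= ltnn {1}/B' eqxx mulrC; congr (_ * _).
    apply: eq_bigr => i ii0; rewrite /B' (_ : (i == m :> nat) = false)//.
    by apply/negbTE; apply: contra ii0 => /eqP im; apply/eqP; exact: val_inj.
  have h : (\int[P]_w (V w * \1_A (Y m w))%:E = (Q * p A)%:E)%E.
    rewrite -QE -(IH B' (ltnW mn) mB').
    by apply: eq_integral => w _; rewrite WE.
  rewrite integral_mkcond.
  transitivity (\int[P]_w (V w * \1_A (Y m w))%:E)%E.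
    apply: eq_integral => w _; rewrite /patch indicE.
    have -> : (w \in Y m @^-1` A) = (Y m w \in A) by apply/idP/idP; rewrite !inE.
    by case: (_ \in _); rewrite ?mulr1// mulr0.
  rewrite h; under eq_integral do rewrite EFinM.
  rewrite ge0_integralZl//.
  + by rewrite (pE mA).
  + by apply/measurable_EFinP; exact: measurable_funTS.
  + by move=> y _; rewrite lee_fin.
Qed.

Lemma iid_prod (g : R -> R) (c : R) n : measurable_fun setT g -> (forall x, 0 <= g x) ->
  (\int[leb]_y (r y * g y)%:E = c%:E)%E ->
  (\int[P]_w (\prod_(i < n) g (Y i w))%:E = (c ^+ n)%:E)%E.
Proof.
move=> mg g0 gc.
have := iid_prod_mixed mg g0 gc (leqnn n) (B := fun=> set0) (fun=> measurable0).
rewrite (eq_bigr (fun=> c)) => [|i _]; last by rewrite ltn_ord.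
rewrite prodr_const card_ord => <-; apply: eq_integral => w _; congr EFin.
by apply: eq_bigr => i _; rewrite ltn_ord.
Qed.

End Independence.

(** * Calculus of upper bounds on expectations *)

Section MeanBound.
Variable R : realType.
Variables (d : measure_display) (Omega : measurableType d) (P : probability Omega R).
Implicit Types (X : Omega -> R) (c : R).

(** Measurability and nonnegativity travel with the bound because additivity and scaling of the
    integral use both. *)
Definition mean_le X c : Prop :=
  [/\ measurable_fun setT X, (forall w, 0 <= X w) & (\int[P]_w (X w)%:E <= c%:E)%E].

Lemma mean_leD X X' c c' : mean_le X c -> mean_le X' c' ->
  mean_le (fun w => X w + X' w) (c + c').
Proof.
move=> [mX X0 Xc] [mX' X0' Xc']; split.
- exact: measurable_funD.
- by move=> w; rewrite addr_ge0.
- under eq_integral do rewrite EFinD.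
  rewrite ge0_integralD//; last 4 first.
  + by move=> w _; rewrite lee_fin.
  + exact/measurable_EFinP.
  + by move=> w _; rewrite lee_fin.
  + exact/measurable_EFinP.
  by rewrite EFinD leeD.
Qed.

Lemma mean_leZ k X c : 0 <= k -> mean_le X c -> mean_le (fun w => k * X w) (k * c).
Proof.
move=> k0 [mX X0 Xc]; split.
- exact: measurable_funM.
- by move=> w; rewrite mulr_ge0.
- under eq_integral do rewrite EFinM.
  rewrite ge0_integralZl//; last 2 first.
  + exact/measurable_EFinP.
  + by move=> w _; rewrite lee_fin.
  by rewrite EFinM lee_wpmul2l// lee_fin.
Qed.

Lemma mean_le_cst k : 0 <= k -> mean_le (fun=> k) k.
Proof.
move=> k0; split => //.
have -> : (\int[P]_w k%:E = \int[P]_w cst k%:E w)%E by [].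
by rewrite integral_cst// -[X in (_ * P X)%E]/setT probability_setT mule1.
Qed.

Lemma mean_le_le X c c' : c <= c' -> mean_le X c -> mean_le X c'.
Proof. by move=> cc' [mX X0 Xc]; split => //; apply: le_trans Xc _; rewrite lee_fin. Qed.

Lemma mean_le_sum n (X : nat -> Omega -> R) (c : nat -> R) :
  (forall k, (k < n)%N -> mean_le (X k) (c k)) ->
  mean_le (fun w => \sum_(k < n) X k w) (\sum_(k < n) c k).
Proof.
elim: n => [|n IH] h.
  under eq_fun do rewrite big_ord0.
  by rewrite big_ord0; exact: mean_le_cst.
under eq_fun do rewrite big_ord_recr/=.
rewrite big_ord_recr/=; apply: mean_leD; last exact: h.
by apply: IH => k kn; apply: h; exact: ltnW.
Qed.

End MeanBound.

(** * Elementary exponential and series estimates *)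

Section ExpBounds.
Variable R : realType.
Implicit Types x q : R.

(** Invert exp(-x) >= 1 - x. The coefficient 2 gives (1 - x)(1 + x + 2 x^2) - 1 = x^2 (1 - 2 x),
    nonnegative up to x = 1/2. *)
Lemma expR_le_quadratic x : x <= 2^-1 -> expR x <= 1 + x + 2 * x ^+ 2.
Proof.
move=> x1; have x10 : 0 < 1 - x by lra.
have h := expR_ge1Dx (- x).
have : expR x <= (1 - x)^-1.
  by rewrite -[expR x]invrK -expRN lef_pV2 ?posrE ?expR_gt0.
move=> /le_trans; apply; rewrite invf_ple ?posrE//; last first.
  by have := sqr_ge0 (x + 4^-1); nra.
have p0 : 0 < 1 + x + 2 * x ^+ 2 by have := sqr_ge0 (x + 4^-1); nra.
rewrite -div1r ler_pdivrMr// -subr_ge0.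
have -> : (1 - x) * (1 + x + 2 * x ^+ 2) - 1 = x ^+ 2 * (1 - 2 * x) by ring.
by rewrite mulr_ge0 ?sqr_ge0//; lra.
Qed.

(** Apply exp(y - j) >= y - j to y = x and y = -x. The factor exp(-j) will pay for a sum over 2^j
    increments. *)
Lemma le_exp_shift (j : nat) x :
  `|x| <= j%:R + expR (- j%:R) * (expR x + expR (- x)).
Proof.
have h (y : R) : y <= j%:R + expR (- j%:R) * expR y.
  by have := expR_ge1Dx (y - j%:R); rewrite expRD mulrC; lra.
have e0 := expR_ge0 (- j%:R : R).
have [x0|x0] := leP 0 x.
  rewrite ger0_norm//; have := h x; have := mulr_ge0 e0 (expR_ge0 (- x)); rewrite mulrDr; lra.
rewrite ltr0_norm//; have := h (- x); have := mulr_ge0 e0 (expR_ge0 x); rewrite mulrDr; lra.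
Qed.

Lemma sum_arith_geometric_le (q g : R) n : 0 < q < 1 -> 0 <= g ->
  \sum_(j < n) q ^+ j * (j%:R + g) <= (g + q / (1 - q)) / (1 - q).
Proof.
move=> /andP[q0 q1] g0; have q10 : 0 < 1 - q by lra.
set c := (g + _) / _.
(* The second summand is the exact tail of the infinite series, whose value is c. *)
suff : \sum_(j < n) q ^+ j * (j%:R + g) + (n%:R / (1 - q) + c) * q ^+ n = c.
  move=> <-; rewrite lerDl mulr_ge0 ?exprn_ge0 ?(ltW q0)//.
  rewrite addr_ge0// /c; apply: divr_ge0; rewrite ?(ltW q10)//.
  by rewrite addr_ge0// divr_ge0// ltW.
elim: n => [|n IH]; first by rewrite big_ord0 mul0r !add0r expr0 mulr1.
rewrite big_ord_recr/= -addrA -[RHS]IH; congr (_ + _).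
rewrite exprS -[n.+1]addn1 natrD /c; field; lra.
Qed.

End ExpBounds.

(** * Dyadic points and chaining along them *)

Section Dyadic.
Variable R : realType.
Variables a b : R.

Definition dyadic (j k : nat) : R := a + (b - a) * k%:R / 2 ^+ j.

Let p20 j : 2 ^+ j != 0 :> R. Proof. by rewrite expf_neq0// pnatr_eq0. Qed.

Lemma dyadic0 j : dyadic j 0 = a.
Proof. by rewrite /dyadic mulr0 mul0r addr0. Qed.

Lemma dyadic_double j k : dyadic j.+1 k.*2 = dyadic j k.
Proof.
by rewrite /dyadic exprS -mul2n natrM; field; rewrite p20.
Qed.

Lemma dyadicS j k : dyadic j k.+1 - dyadic j k = (b - a) / 2 ^+ j.
Proof. by rewrite /dyadic -addn1 natrD; field; rewrite p20. Qed.

(** At level j + 1 an even index is a point of level j and an odd one lies a single step to the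
    right of such a point, so each level costs at most one increment. *)
Lemma dyadic_chain (xi : R -> R) (A : nat -> R) :
  (forall j, 0 <= A j) ->
  (forall j k, (k < 2 ^ j)%N -> `|xi (dyadic j k.+1) - xi (dyadic j k)| <= A j) ->
  forall J k, (k <= 2 ^ J)%N ->
    `|xi (dyadic J k)| <= `|xi a| + \sum_(j < J.+1) A j.
Proof.
move=> A0 H; elim=> [|J IH] k kJ.
  rewrite big_ord_recr big_ord0/= add0r.
  case: k kJ => [|[|//]] _; first by rewrite dyadic0 lerDl.
  have := H 0%N 0%N erefl; rewrite dyadic0 => h.
  by rewrite -[X in `|X| <= _](subrKC (xi a)) (le_trans (ler_normD _ _))// lerD2l.
rewrite big_ord_recr/= addrA.
have kh : (k./2 <= 2 ^ J)%N.
  by rewrite -(doubleK (2 ^ J)%N) half_leq// -mul2n -expnS.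
have := IH _ kh; rewrite -dyadic_double => IHk.
have [ok|ek] := boolP (odd k).
  have kE : k = (k./2).*2.+1 by rewrite -[LHS]odd_double_half ok.
  have := H J.+1 (k./2).*2; rewrite -kE => /(_ kJ) h.
  rewrite -[X in `|X| <= _](subrKC (xi (dyadic J.+1 (k./2).*2))).
  by rewrite (le_trans (ler_normD _ _))// lerD.
have -> : k = (k./2).*2 by rewrite -[LHS]odd_double_half (negbTE ek).
by apply: le_trans IHk _; rewrite lerDl.
Qed.

Lemma dyadic_approx (z : R) J : a < b -> Iab a b z ->
  exists2 k, (k <= 2 ^ J)%N & `|z - dyadic J k| <= (b - a) / 2 ^+ J.
Proof.
move=> ab /IabE/andP[az zb]; have L0 : 0 < b - a by lra.
have p2 : 0 < 2 ^+ J :> R by rewrite exprn_gt0.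
pose t := (z - a) / (b - a) * 2 ^+ J.
have t0 : 0 <= t by rewrite mulr_ge0 ?divr_ge0 ?(ltW p2) ?(ltW L0)//; lra.
have /andP[tl tu] := truncn_itv t0.
exists (Num.truncn t).
  rewrite -(ler_nat R) natrX (le_trans tl)// /t ler_piMl ?(ltW p2)//.
  by rewrite ler_pdivrMr// mul1r; lra.
have -> : z - dyadic J (Num.truncn t) = (b - a) / 2 ^+ J * (t - (Num.truncn t)%:R).
  by rewrite /dyadic /t; field; rewrite p20 gt_eqF.
have LJ : 0 <= (b - a) / 2 ^+ J by rewrite divr_ge0 ?(ltW p2) ?(ltW L0).
rewrite normrM (ger0_norm LJ) ler_piMr// ger0_norm ?subr_ge0//.
move: tu; rewrite -addn1 natrD; lra.
Qed.

End Dyadic.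

(** * Exponential moments of centered empirical means *)

Section EmpiricalProcess.
Variable R : realType.
Variables (a b : R) (r : R -> R).
Variables (d : measure_display) (Omega : measurableType d) (P : probability Omega R).
Variable Y : nat -> Omega -> R.
Local Notation leb := (@lebesgue_measure R).
Local Notation D := (Iab a b).
Local Notation L2 := (L2 a b).
Local Notation "<< g , h >>" := (inner a b g h).
Hint Resolve measurable_Iab : core.
Hypothesis cr : continuous r.
Hypothesis r0 : forall x, 0 <= r x.
Hypothesis rsupp : supported_in a b r.
Hypothesis iid : iid_sample P Y r.

Let mr : measurable_fun setT r. Proof. exact: continuous_measurable_fun. Qed.

Let mY i : measurable_fun setT (Y i). Proof. by case: iid. Qed.

Let Lr : L2 r.
Proof. by apply: L2_continuous; exact: continuous_subspaceT. Qed.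

Let L2_bnd (u : R -> R) (k : R) : measurable_fun setT u -> (forall y, `|u y| <= k) -> L2 u.
Proof.
by move=> mu uk; apply: (@L2_bounded _ _ _ _ k) => //; exact: measurable_funTS.
Qed.

Let L1 : L2 (fun=> 1).
Proof. by apply: (@L2_bnd _ 1) => // y; rewrite normr1. Qed.

Let integral_density g : L2 g ->
  (\int[leb]_y (r y * g y)%:E = (<< r, g>>)%:E)%E.
Proof.
move=> Lg; rewrite /inner /Rintegral fineK; last first.
  by apply: integrable_fin_num => //; exact: L2_mul_integrable.
rewrite [RHS]integral_mkcond; apply: eq_integral => y _; rewrite /patch.
by case: ifPn => // /negP; rewrite inE => Dy; rewrite rsupp// mul0r.
Qed.

Let inner_r1 : << r, (fun=> 1)>> = 1.
Proof.
apply: EFin_inj; rewrite -integral_density//.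
under eq_integral do rewrite mulr1.
exact: iid_density_integral1 iid.
Qed.

Let inner_r_cst c : << r, (fun=> c)>> = c.
Proof.
have -> : << r, (fun=> c)>> = << r, (fun x => c * 1)>>.
  by apply: eq_inner => // x _; rewrite mulr1.
by rewrite innerZr// inner_r1 mulr1.
Qed.

Let inner_r_le g h : L2 g -> L2 h -> (forall y, g y <= h y) -> << r, g>> <= << r, h>>.
Proof.
move=> Lg Lh gh; apply: le_Rintegral => //; try exact: L2_mul_integrable.
by move=> y _; rewrite ler_wpM2l.
Qed.

Lemma density_mean_norm_le (u : R -> R) (k : R) : measurable_fun setT u -> (forall y, `|u y| <= k) -> `|<< r, u>>| <= k.
Proof.
move=> mu uk; have Lu := L2_bnd mu uk.
have Lc c : L2 (fun=> c) by apply: (@L2_bnd _ `|c|).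
rewrite ler_norml; apply/andP; split.
  rewrite -[leLHS]inner_r_cst; apply: inner_r_le => // y.
  by have := uk y; rewrite ler_norml => /andP[].
rewrite -[leRHS]inner_r_cst; apply: inner_r_le => // y.
by have := uk y; rewrite ler_norml => /andP[].
Qed.

Definition centered_mean (u : R -> R) n w :=
  n%:R^-1 * \sum_(i < n) (u (Y i w) - << r, u>>).

Lemma centered_mean_norm_le (u : R -> R) (k : R) n w : measurable_fun setT u ->
  (forall y, `|u y| <= k) -> (0 < n)%N -> `|centered_mean u n w| <= 2 * k.
Proof.
move=> mu uk n0; have nR : 0 < n%:R :> R by rewrite ltr0n.
rewrite normrM gtr0_norm ?invr_gt0// mulrC ler_pdivrMr//.
apply: le_trans (ler_norm_sum _ _ _) _.
rewrite mulr_natr -[n in X in _ <= X]card_ord -sumr_const; apply: ler_sum => i _.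
apply: le_trans (ler_normB _ _) _.
by have := uk (Y i w); have := density_mean_norm_le mu uk; lra.
Qed.

(* Sub-Gaussian bound at the single scale 4 k / sqrt n, which is all that the
   chaining argument uses. *)
Lemma centered_mean_exp (u : R -> R) (k : R) n : measurable_fun setT u ->
  0 < k -> (forall y, `|u y| <= k) -> (0 < n)%N ->
  mean_le P (fun w => expR (centered_mean u n w / (4 * k / Num.sqrt n%:R))) (expR 1).
Proof.
move=> mu k0 uk n0.
have nR : 0 < n%:R :> R by rewrite ltr0n.
have Lu := L2_bnd mu uk.
have s0 : 0 < Num.sqrt n%:R :> R by rewrite sqrtr_gt0.
have s2 : Num.sqrt n%:R ^+ 2 = n%:R :> R by rewrite sqr_sqrtr// ltW.
have s1 : 1 <= Num.sqrt n%:R :> R.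
  by rewrite -[leLHS]sqrtr1 ler_sqrt// ler1n.
pose m := << r, u>>.
have mk : `|m| <= k by exact: density_mean_norm_le.
(* With this t the exponent x = t (u - m) has |x| <= 1 / (2 sqrt n) <= 1/2 and 2 x^2 <= 1/n. Each
   factor then has mean at most 1 + 1/n <= exp(1/n), and the n factors multiply to at most e. *)
pose t := (4 * k * Num.sqrt n%:R)^-1 : R.
pose g y := expR (t * (u y - m)).
have t0 : 0 < t by rewrite invr_gt0 !mulr_gt0.
have xb y : `|t * (u y - m)| <= (2 * Num.sqrt n%:R)^-1.
  rewrite normrM gtr0_norm//.
  apply: (@le_trans _ _ (t * (2 * k))).
    rewrite ler_pM2l// (le_trans (ler_normB _ _))//.
    by have := uk y; move: mk; lra.
  by rewrite le_eqVlt /t; apply/orP; left; apply/eqP; field; rewrite !gt_eqF.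
have xh y : t * (u y - m) <= 2^-1.
  apply: le_trans (ler_norm _) _; apply: le_trans (xb y) _.
  by rewrite lef_pV2 ?posrE ?mulr_gt0// ler_pMr.
have x2 y : 2 * (t * (u y - m)) ^+ 2 <= n%:R^-1.
  rewrite -[_ ^+ 2]real_normK ?num_real//.
  apply: (@le_trans _ _ (2 * ((2 * Num.sqrt n%:R)^-1 ^+ 2))).
    by rewrite ler_pM2l// lerXn2r ?nnegrE// invr_ge0 mulr_ge0// ltW.
  rewrite exprVn exprMn s2.
  have -> : 2 * (2 ^+ 2 * n%:R)^-1 = 2^-1 * n%:R^-1 :> R by field; rewrite gt_eqF.
  by rewrite ler_piMl ?invr_ge0 ?(ltW nR)//; lra.
have gb y : g y <= (1 + n%:R^-1) + t * (u y - m).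
  by apply: le_trans (expR_le_quadratic (xh y)) _; have := x2 y; lra.
have mg : measurable_fun setT g.
  apply: measurableT_comp => //; apply: measurable_funM => //.
  exact: measurable_funB.
have g0 y : 0 <= g y by exact: expR_ge0.
have Lg : L2 g.
  apply: (@L2_bnd _ (expR 2^-1)) => // y.
  by rewrite ger0_norm// ler_expR.
have Lc c : L2 (fun=> c) by apply: (@L2_bnd _ `|c|).
have gc : << r, g>> <= expR (n%:R^-1).
  apply: le_trans (expR_ge1Dx _).
  have Lh : L2 (fun y => t * (u y - m)) by apply: L2Z; exact: L2B.
  apply: (@le_trans _ _ << r, (fun y => (1 + n%:R^-1) + t * (u y - m))>>).
    by apply: inner_r_le => //; exact: L2D.
  rewrite innerDr// inner_r_cst innerZr//; last exact: L2B.
  by rewrite innerBr// inner_r_cst subrr mulr0 addr0.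
have gE : 0 <= << r, g>>.
  by apply: Rintegral_ge0 => y _; rewrite mulr_ge0.
have eE w : expR (centered_mean u n w / (4 * k / Num.sqrt n%:R)) = \prod_(i < n) g (Y i w).
  rewrite -expR_sum -mulr_sumr; congr expR.
  rewrite /centered_mean -/m; set S := \sum_(i < n) _.
  rewrite (_ : n%:R^-1 = (Num.sqrt n%:R ^+ 2)^-1); last by rewrite s2.
  rewrite /t; field.
  by rewrite !gt_eqF.
split.
- under eq_fun do rewrite eE.
  by apply: measurable_prod => i _; apply: measurableT_comp.
- by move=> w; exact: expR_ge0.
- under eq_integral do rewrite eE.
  rewrite (iid_prod mr r0 iid n mg g0 (integral_density Lg)) lee_fin.
  apply: (@le_trans _ _ (expR (n%:R^-1) ^+ n)).
    by rewrite lerXn2r ?nnegrE// expR_ge0.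
  by rewrite -expRM_natl divff// gt_eqF.
Qed.

Lemma centered_mean_exp2 (u : R -> R) (k : R) n : measurable_fun setT u ->
  0 < k -> (forall y, `|u y| <= k) -> (0 < n)%N ->
  mean_le P (fun w => expR (centered_mean u n w / (4 * k / Num.sqrt n%:R)) +
                      expR (- (centered_mean u n w / (4 * k / Num.sqrt n%:R)))) (2 * expR 1).
Proof.
move=> mu k0 uk n0; have -> : 2 * expR 1 = expR 1 + expR 1 :> R by ring.
apply: mean_leD; first exact: centered_mean_exp.
have Lu := L2_bnd mu uk.
have -> : (fun w => expR (- (centered_mean u n w / (4 * k / Num.sqrt n%:R)))) =
          (fun w => expR (centered_mean (fun y => -1 * u y) n w / (4 * k / Num.sqrt n%:R))).
  apply/funext => w; rewrite -mulNr.
  suff -> : - centered_mean u n w = centered_mean (fun y => -1 * u y) n w by [].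
  rewrite /centered_mean -mulrN -sumrN; congr (_ * _); apply: eq_bigr => i _.
  by rewrite innerZr//; ring.
apply: centered_mean_exp => //; first exact: measurable_funM.
by move=> y; rewrite normrM normrN normr1 mul1r.
Qed.

End EmpiricalProcess.

(** * The supremum of the empirical error *)

Section Chaining.
Variable R : realType.
Variables (a b M s : R) (r f : R -> R).
Variables (d : measure_display) (Omega : measurableType d) (P : probability Omega R).
Variable Y : nat -> Omega -> R.
Local Notation D := (Iab a b).
Local Notation L2 := (L2 a b).
Hypothesis ab : a < b.
Hypothesis cr : continuous r.
Hypothesis r0 : forall x, 0 <= r x.
Hypothesis rsupp : supported_in a b r.
Hypothesis iid : iid_sample P Y r.
Hypothesis M0 : 0 < M.
Hypothesis s01 : 0 < s <= 1.
Hypothesis mf : measurable_fun setT f.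
Hypothesis fM : forall x, `|f x| <= M.
Hypothesis fH : forall x x', `|f x - f x'| <= M * `|x - x'| `^ s.

Let q : R := 2^-1 `^ s.

Let q01 : 0 < q < 1.
Proof.
have /andP[s0 _] := s01; rewrite /q powR_gt0 ?invr_gt0//=.
have h : (2^-1 : R) < 1 by rewrite invf_lt1// ltr1n.
have := @gt0_ltr_powR R s s0 2^-1 1; rewrite powR1; apply => //; rewrite nnegrE//.
Qed.

(** Holder modulus of f at the mesh width of level j; q is its ratio between consecutive levels. *)
Let kap j := M * ((b - a) / 2 ^+ j) `^ s.

Let kapE j : kap j = M * (b - a) `^ s * q ^+ j.
Proof.
have L0 : 0 <= b - a by rewrite subr_ge0 ltW.
rewrite /kap powRM ?invr_ge0 ?exprn_ge0// mulrA; congr (_ * _).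
have h2 : 0 <= 2^-1 :> R by rewrite invr_ge0.
by rewrite -exprVn -(powR_mulrn j h2) powRAC powR_mulrn// powR_ge0.
Qed.

Let kap0 j : 0 < kap j.
Proof. by rewrite mulr_gt0// powR_gt0// divr_gt0 ?subr_gt0 ?exprn_gt0. Qed.

Definition empirical_error n w z :=
  hatTstar_r f n (fun i => Y i w) z - Tstar a b f r z.

Let mfx x : measurable_fun setT (fun y : R => f (y - x)).
Proof. by apply: measurableT_comp => //; exact: measurable_funB. Qed.

Let Lfx x : L2 (fun y => f (y - x)).
Proof. by apply: (@L2_bounded _ _ _ _ M) => //; exact: measurable_funTS. Qed.

Let Lr : L2 r.
Proof. by apply: L2_continuous; exact: continuous_subspaceT. Qed.

Let errE n w z : (0 < n)%N ->
  empirical_error n w z = centered_mean a b r Y (fun y => f (y - z)) n w.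
Proof.
move=> n0; rewrite /empirical_error /hatTstar_r /centered_mean sumrB sumr_const card_ord.
by rewrite mulrBr -[inner _ _ _ _ *+ n]mulr_natl mulrA mulVf ?mul1r// pnatr_eq0 -lt0n.
Qed.

Let diff x x' y := f (y - x) - f (y - x').

Let mdiff x x' : measurable_fun setT (diff x x').
Proof. exact: measurable_funB. Qed.

Let diff_le x x' y : `|diff x x' y| <= M * `|x - x'| `^ s.
Proof.
apply: le_trans (fH _ _) _; rewrite (_ : y - x - (y - x') = - (x - x')); last by ring.
by rewrite normrN.
Qed.

Let errB n w x x' : (0 < n)%N ->
  empirical_error n w x - empirical_error n w x' =
  centered_mean a b r Y (diff x x') n w.
Proof.
move=> n0; rewrite !errE// /centered_mean -mulrBr -sumrB; congr (_ * _).
by apply: eq_bigr => i _; rewrite /diff innerBr//; ring.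
Qed.

(** The three summands come from the value at the anchor a, from the series of level increments, and
    from the gap below the finest level. Only a, b, M and s occur, whence uniformity over the
    class. *)
Definition chain_const : R := 8 * M * expR 1 +
  4 * M * (b - a) `^ s * ((2 * expR 1 + q / (1 - q)) / (1 - q)) + 1.

(* Dyadic chaining down to a level J where the Holder modulus is below
   1 / sqrt n; at level j the 2^j increments are controlled simultaneously
   through |x| <= j + e^-j (e^x + e^-x), which costs a factor linear in j,
   summable against 2^(-j s). *)
Lemma empirical_error_sup n : (0 < n)%N ->
  exists X : Omega -> R, mean_le P X (chain_const / Num.sqrt n%:R) /\
    forall w z, D z -> `|empirical_error n w z| <= X w.
Proof.
move=> n0.
have nR : 0 < n%:R :> R by rewrite ltr0n.
have sn : 0 < Num.sqrt n%:R :> R by rewrite sqrtr_gt0.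
have /andP[q0 q1] := q01; have q10 : 0 < 1 - q by rewrite subr_gt0.
have L0 : 0 <= b - a by rewrite subr_ge0 ltW.
pose tau j := 4 * kap j / Num.sqrt n%:R.
have tau0 j : 0 < tau j by rewrite divr_gt0// mulr_gt0.
pose Z j k w := centered_mean a b r Y (diff (dyadic a b j k.+1) (dyadic a b j k)) n w.
pose E j k w := expR (Z j k w / tau j) + expR (- (Z j k w / tau j)).
have E0 j k w : 0 <= E j k w by rewrite addr_ge0 ?expR_ge0.
have Emean j k : mean_le P (E j k) (2 * expR 1).
  apply: centered_mean_exp2 => // y.
  apply: le_trans (diff_le _ _ _) _; rewrite dyadicS ger0_norm//.
  by rewrite divr_ge0// exprn_ge0.
pose A j w := tau j * (j%:R + expR (- j%:R) * \sum_(k < 2 ^ j) E j k w).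
have A0 j w : 0 <= A j w.
  rewrite mulr_ge0 ?(ltW (tau0 j))// addr_ge0// mulr_ge0 ?expR_ge0//.
  exact: sumr_ge0.
have Amean j : mean_le P (A j) (tau j * (j%:R + 2 * expR 1)).
  apply: mean_leZ; first exact: ltW.
  apply: mean_leD; first exact: mean_le_cst.
  apply: (@mean_le_le _ _ _ _ _ (expR (- j%:R) * \sum_(k < 2 ^ j) (2 * expR 1))); last first.
    apply: mean_leZ; first exact: expR_ge0.
    by apply: (@mean_le_sum _ _ _ P _ (E j) (fun=> 2 * expR 1)) => k _; exact: Emean.
  (* Since e >= 2, exp(-j) 2^j <= 1: the sum over all increments of a level costs no more than a
     single one. *)
  rewrite sumr_const card_ord -[_ *+ (2 ^ j)]mulr_natl mulrA ler_piMl ?mulr_ge0 ?expR_ge0//.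
  rewrite expRN mulrC ler_pdivrMr ?expR_gt0// mul1r.
  rewrite -[X in expR X]mulr1 expRM_natl natrX lerXn2r ?nnegrE ?expR_ge0//.
  by have := expR_ge1Dx (1 : R); lra.
have Abound j k w : (k < 2 ^ j)%N ->
    `|empirical_error n w (dyadic a b j k.+1) - empirical_error n w (dyadic a b j k)| <= A j w.
  move=> kj; rewrite errB// -/(Z j k w).
  have -> : `|Z j k w| = tau j * `|Z j k w / tau j|.
    by rewrite [`|_ / tau j|]normrM normfV (gtr0_norm (tau0 j)) mulrC divfK// gt_eqF.
  rewrite ler_pM2l//; apply: le_trans (le_exp_shift j _) _.
  rewrite lerD2l ler_wpM2l ?expR_ge0// -/(E j k w).
  by rewrite (bigD1 (Ordinal kj))//= lerDl sumr_ge0.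
pose ta := 4 * M / Num.sqrt n%:R.
have ta0 : 0 < ta by rewrite divr_gt0// mulr_gt0.
pose Za w := centered_mean a b r Y (fun y => f (y - a)) n w.
pose Xa w := ta * (expR (Za w / ta) + expR (- (Za w / ta))).
have Xamean : mean_le P Xa (ta * (2 * expR 1)).
  by apply: mean_leZ; [exact: ltW|exact: centered_mean_exp2].
have Xab w : `|empirical_error n w a| <= Xa w.
  rewrite errE// -/(Za w).
  have -> : `|Za w| = ta * `|Za w / ta|.
    by rewrite [`|_ / ta|]normrM normfV (gtr0_norm ta0) mulrC divfK// gt_eqF.
  rewrite ler_pM2l//; apply: le_trans (le_exp_shift 0 _) _.
  by rewrite oppr0 expR0 mul1r add0r.
(* J depends on n, but the final bound does not depend on J because the level sum is dominated by
   its infinite series. The factor 2 is that of the deterministic bound [centered_mean_norm_le]. *)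
have [J HJ] : exists J, 2 * kap J <= (Num.sqrt n%:R)^-1.
  have c0 : 0 < 2 * (M * (b - a) `^ s) by rewrite !mulr_gt0// powR_gt0// subr_gt0.
  have nq : `|q| < 1 by rewrite gtr0_norm.
  have e0 : 0 < (Num.sqrt n%:R)^-1 / (2 * (M * (b - a) `^ s)) by rewrite divr_gt0// invr_gt0.
  move/cvgrPdist_le : (cvg_expr nq) => /(_ _ e0)[J _ /(_ J (leqnn J))].
  rewrite sub0r normrN ger0_norm ?exprn_ge0 ?(ltW q0)// ler_pdivlMr// => h.
  exists J; rewrite kapE; apply: le_trans h; rewrite le_eqVlt; apply/orP; left; apply/eqP; ring.
exists (fun w => Xa w + \sum_(j < J.+1) A j w + (Num.sqrt n%:R)^-1); split.
- apply: (@mean_le_le _ _ _ _ _ (ta * (2 * expR 1) +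
     \sum_(j < J.+1) tau j * (j%:R + 2 * expR 1) + (Num.sqrt n%:R)^-1)); last first.
    apply: mean_leD; last by apply: mean_le_cst; rewrite invr_ge0 ltW.
    apply: mean_leD => //.
    exact: (@mean_le_sum _ _ _ P _ A (fun j => tau j * (j%:R + 2 * expR 1))).
  have -> : \sum_(j < J.+1) tau j * (j%:R + 2 * expR 1) =
      4 * M * (b - a) `^ s / Num.sqrt n%:R * \sum_(j < J.+1) q ^+ j * (j%:R + 2 * expR 1).
    rewrite mulr_sumr; apply: eq_bigr => j _; rewrite /tau kapE; field.
    by rewrite gt_eqF.
  have g0 : 0 <= 2 * expR 1 :> R by rewrite mulr_ge0 ?expR_ge0.
  have := sum_arith_geometric_le J.+1 q01 g0.
  rewrite /chain_const; set S1 := \sum_(j < J.+1) _; set S2 := (_ + q / _) / _ => S12.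
  have -> : (8 * M * expR 1 + 4 * M * (b - a) `^ s * S2 + 1) / Num.sqrt n%:R =
      ta * (2 * expR 1) + 4 * M * (b - a) `^ s / Num.sqrt n%:R * S2 + (Num.sqrt n%:R)^-1.
    by rewrite /ta; field; rewrite gt_eqF.
  rewrite lerD2r lerD2l; apply: ler_wpM2l => //.
  by rewrite divr_ge0 ?mulr_ge0 ?powR_ge0//; exact: ltW.
- move=> w z Dz; have [k kJ zk] := dyadic_approx J ab Dz.
  have h1 := dyadic_chain (fun j => A0 j w) (fun j k => @Abound j k w) kJ.
  have h2 : `|empirical_error n w z - empirical_error n w (dyadic a b J k)| <= 2 * kap J.
    rewrite errB//; apply: (centered_mean_norm_le (P := P)) => // y.
    apply: le_trans (diff_le _ _ _) _; rewrite ler_pM2l//.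
    have /andP[s0 _] := s01.
    by apply: ge0_ler_powR; rewrite ?nnegrE ?divr_ge0 ?exprn_ge0// ltW.
  have := Xab w.
  have : `|empirical_error n w z| <= `|empirical_error n w (dyadic a b J k)| +
     `|empirical_error n w z - empirical_error n w (dyadic a b J k)|.
    by rewrite -[X in `|X| <= _](subrKC (empirical_error n w (dyadic a b J k))) ler_normD.
  move: h1 h2 HJ; set S1 := \sum_(j < J.+1) _; lra.
Qed.

End Chaining.

(** * The uniform rate *)

Section UniformRate.
Variable R : realType.

Lemma continuous_sum n (F : nat -> R -> R) : (forall k, continuous (F k)) ->
  continuous (fun x => \sum_(k < n) F k x).
Proof.
move=> cF; elim: n => [|n IH].
  by under eq_fun do rewrite big_ord0; move=> x; exact: cvg_cst.
under eq_fun do rewrite big_ord_recr/=.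
by move=> x; apply: cvgD; [exact: IH|exact: cF].
Qed.

Lemma inner_le_sup (a b X : R) (g : R -> R) : a <= b -> L2 a b g ->
  (forall z, Iab a b z -> `|g z| <= X) -> inner a b g g <= X ^+ 2 * (b - a).
Proof.
move=> ab Lg gX; have mI := measurable_Iab a b.
have -> : X ^+ 2 * (b - a) = Rintegral (@lebesgue_measure R) (Iab a b) (cst (X ^+ 2)).
  by rewrite Rintegral_cst//; congr (_ * _); exact: (esym (congr1 fine (lebesgue_Iab ab))).
apply: le_Rintegral => //.
- exact: L2_mul_integrable.
- exact: integrable_cst_Iab.
- move=> x Dx; rewrite -expr2 -[g x ^+ 2]real_normK ?num_real//.
  by rewrite lerXn2r ?nnegrE ?gX// (le_trans _ (gX x Dx)).
Qed.

Lemma powR_three_halves (alpha : R) : 0 < alpha ->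
  alpha `^ (3 / 2) = alpha * Num.sqrt alpha.
Proof.
move=> al0; have -> : 3 / 2 = 1 + 2^-1 :> R by field.
by rewrite powRD ?gt_eqF ?implybT// powRr1 ?powR12_sqrt// ltW.
Qed.

(** The L2 norm of xi is at most its sup norm times sqrt L, and alpha <= 1 lets alpha^(-3/2) absorb
    the milder alpha^(-1). *)
Lemma variance_term_bound (alpha C X L I : R) : 0 < alpha <= 1 -> 0 <= C -> 0 <= X ->
  0 <= L -> 0 <= I -> I <= X ^+ 2 * L ->
  (X + C * Num.sqrt (I / (2 * alpha))) / alpha <=
  (1 + C * Num.sqrt L) / alpha `^ (3 / 2) * X.
Proof.
move=> /andP[al0 al1] C0 X0 L0 I0 IX; rewrite powR_three_halves//.
have s0 : 0 < Num.sqrt alpha by rewrite sqrtr_gt0.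
have s1 : Num.sqrt alpha <= 1 by rewrite -[leRHS]sqrtr1 ler_sqrt.
have h : Num.sqrt (I / (2 * alpha)) * Num.sqrt alpha <= X * Num.sqrt L.
  rewrite -sqrtrM; last by rewrite divr_ge0 ?mulr_ge0// ltW.
  rewrite -[X in X * Num.sqrt L](ger0_norm X0) -sqrtr_sqr -sqrtrM ?sqr_ge0//.
  rewrite ler_sqrt ?mulr_ge0 ?sqr_ge0//.
  have -> : I / (2 * alpha) * alpha = I / 2 by field; rewrite gt_eqF.
  by move: IX; lra.
rewrite ler_pdivrMr//.
have -> : (1 + C * Num.sqrt L) / (alpha * Num.sqrt alpha) * X * alpha =
    (X + C * (X * Num.sqrt L)) / Num.sqrt alpha by field; rewrite !gt_eqF.
rewrite ler_pdivlMr// mulrDl -mulrA; apply: lerD; last by rewrite ler_wpM2l.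
by rewrite ler_piMr.
Qed.

Lemma uniform_rate (a b beta C M s alpha : R) (n : nat) (phi f : R -> R)
    (d : measure_display) (Omega : measurableType d) (P : probability Omega R)
    (Y : nat -> Omega -> R) (phihat : Omega -> R -> R) :
  0 < beta -> 0 < C -> 0 < M -> 0 < alpha <= 1 -> (0 < n)%N ->
  is_density phi -> is_density f ->
  classF a b beta C M phi f -> assumptionD a b s M phi f ->
  iid_sample P Y (Top a b f phi) ->
  (forall w, is_resolvent a b f alpha (hatTstar_r f n (fun i => Y i w)) (phihat w)) ->
  (\int[P]_w supnorm a b (fun z => (phihat w z - phi z)%R)
     <= ((Rconst beta C + chain_const a b M s * (1 + C * Num.sqrt (b - a))) *
         ((alpha `^ (3 / 2) * Num.sqrt n%:R)^-1 + alpha `^ Num.min beta 1))%R%:E)%E.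
Proof.
move=> b0 C0 M0 al n0 [_ [phi0 _]] df FF AD iid res.
have /andP[al0 al1] := al; have [mf [f0 intf]] := df.
have [ab s01 [[cf _ cr] [_ _ rsupp]] [fM fH] _] := AD.
have [[cphi _] cTs opC _ _] := FF.
have L0 : 0 <= b - a by rewrite subr_ge0 ltW.
pose r := Top a b f phi.
have r0 x : 0 <= r x by apply: Rintegral_ge0 => z _; rewrite mulr_ge0.
have [X [mX Xb]] := empirical_error_sup ab cr r0 rsupp iid M0 s01 mf fM fH n0.
have [_ X0 _] := mX.
have Lphi : L2 a b phi by exact: L2_continuous.
have Lr : L2 a b r by apply: L2_continuous; exact: continuous_subspaceT.
pose B := Rconst beta C * alpha `^ Num.min beta 1.
pose k := (1 + C * Num.sqrt (b - a)) / alpha `^ (3 / 2).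
have Rc0 : 0 <= Rconst beta C.
  rewrite /Rconst mulr_ge0 ?sqr_ge0// addr_ge0//; case: ifP => // _; rewrite ?powR_ge0//.
  by rewrite mulr_ge0 ?powR_ge0.
have B0 : 0 <= B by rewrite mulr_ge0 ?powR_ge0.
have kn0 : 0 <= 1 + C * Num.sqrt (b - a).
  by rewrite addr_ge0// mulr_ge0 ?sqrtr_ge0// ltW.
have k0 : 0 <= k by rewrite divr_ge0 ?powR_ge0.
have bnd w z : Iab a b z -> `|phihat w z - phi z| <= B + k * X w.
  move=> Dz; have [Lph eph] := res w.
  pose xi := empirical_error a b r f Y n w.
  have cxi : {within Iab a b, continuous xi}.
    have ch : {within Iab a b, continuous (hatTstar_r f n (fun i => Y i w))}.
      apply: continuous_subspaceT => x; apply: cvgM; first exact: cvg_cst.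
      apply: (@continuous_sum _ (fun i x => f (Y i w - x))) => i y.
      apply: continuous_comp; last exact: cf.
      by apply: cvgB; [exact: cvg_cst|exact: cvg_id].
    by move=> x; apply: cvgB; [exact: ch|exact: (cTs r Lr)].
  have Lv : L2 a b (fun x => phihat w x - phi x) by exact: L2B.
  have eqn x : Iab a b x -> alpha * (phihat w x - phi x) +
      TstarT a b f (fun x => phihat w x - phi x) x = xi x - alpha * phi x.
    move=> Dx; rewrite (TstarTB mf f0 intf ab opC)// mulrBr /xi /empirical_error.
    by have := eph x Dx; rewrite /r -/(TstarT a b f phi x); lra.
  have Lxi : L2 a b xi by exact: L2_continuous.
  have := classF_error_bound b0 C0 al0 df FF cxi (Xb w) Lv eqn Dz.
  move=> /le_trans; apply; rewrite lerD2l.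
  apply: variance_term_bound => //; first exact: ltW.
  - exact: inner_ge0.
  - by apply: inner_le_sup => //; [exact: ltW|exact: Xb].
apply: (@le_trans _ _ (\int[P]_w (B + k * X w)%:E)%E).
  apply: ge0_le_integral_nonmeasurable => w.
    (* An empty supremum would be -oo; the point a makes the sup norm nonnegative. *)
    have Da : Iab a b a by apply/IabE; rewrite lexx ltW.
    apply: (@le_trans _ _ (`|phihat w a - phi a|)%:E); first by rewrite lee_fin.
    by apply: ereal_sup_ubound; exists a.
  by apply: ge_ereal_sup => _ [z Dz <-]; rewrite lee_fin bnd.
have [_ _ h] := mean_leD (mean_le_cst P B0) (mean_leZ k0 mX).
apply: le_trans h _; rewrite lee_fin.
have a0 : 0 < alpha `^ (3 / 2) by rewrite powR_gt0.
have sn : 0 < Num.sqrt n%:R :> R by rewrite sqrtr_gt0 ltr0n.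
(* Read off from the constant bounding the expectation of a nonnegative variable. *)
have cc0 : 0 <= chain_const a b M s.
  have [mX0 X00 hX] := mX.
  have : (0 <= (chain_const a b M s / Num.sqrt n%:R)%:E)%E.
    by apply: le_trans hX; apply: integral_ge0 => w _; rewrite lee_fin.
  by rewrite lee_fin pmulr_lge0// invr_gt0.
have -> : k * (chain_const a b M s / Num.sqrt n%:R) =
    chain_const a b M s * (1 + C * Num.sqrt (b - a)) * (alpha `^ (3 / 2) * Num.sqrt n%:R)^-1.
  by rewrite /k; field; rewrite !gt_eqF.
rewrite /B; set x := (_ * _)^-1; set y := alpha `^ _; set c := chain_const _ _ _ _ * _.
have c0 : 0 <= c by rewrite mulr_ge0.
have x0 : 0 <= x by rewrite invr_ge0 mulr_ge0// ltW.
have y0 : 0 <= y by rewrite powR_ge0.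
have -> : (Rconst beta C + c) * (x + y) =
  Rconst beta C * y + c * x + (Rconst beta C * x + c * y) by ring.
by rewrite lerDl addr_ge0// mulr_ge0.
Qed.

End UniformRate.

Theorem theorem7 (R : realType) (a b beta C M : R) :
  0 < beta -> 0 < C -> 0 < M ->
  (* Part 1: deterministic bound under the source condition *)
  (forall (phi f : R -> R) (alpha : R) (n : nat) (y : nat -> R)
          (phihat nu : R -> R) (h : nat -> R -> R),
     is_density phi -> is_density f ->
     classF a b beta C M phi f ->
     0 < alpha -> (0 < n)%N ->
     is_resolvent a b f alpha (hatTstar_r f n y) phihat ->
     is_resolvent a b f alpha
       (fun z => hatTstar_r f n y z - Tstar a b f (Top a b f phi) z) nu ->
     (forall i, (i < n)%N -> is_resolvent a b f alpha (X2 a b f phi (y i)) (h i)) ->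
     (supnorm a b (fun z => (phihat z - phi z)%R)
        <= supnorm a b nu + (Rconst beta C * alpha `^ Num.min beta 1)%R%:E)%E
     /\ (forall z, Iab a b z -> nu z = n%:R^-1 * \sum_(i < n) h i z))
  /\
  (* Part 2: uniform rate of the expected sup-norm error under Assumption D *)
  (forall (s : R) (alpha : nat -> R),
     (forall n, 0 < alpha n) -> alpha @ \oo --> (0 : R) ->
     exists K : R, exists N : nat, forall n : nat, (N <= n)%N ->
       forall (phi f : R -> R),
         is_density phi -> is_density f ->
         classF a b beta C M phi f -> assumptionD a b s M phi f ->
         forall (d : measure_display) (Omega : measurableType d)
                (P : probability Omega R) (Y : nat -> Omega -> R)
                (phihat : Omega -> R -> R),
           iid_sample P Y (Top a b f phi) ->
           (forall w, is_resolvent a b f (alpha n)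
                        (hatTstar_r f n (fun i => Y i w)) (phihat w)) ->
           (\int[P]_w supnorm a b (fun z => (phihat w z - phi z)%R)
              <= (K * ((alpha n `^ (3 / 2) * Num.sqrt n%:R)^-1
                       + alpha n `^ Num.min beta 1))%R%:E)%E).
Proof.
move=> b0 C0 M0; split.
  move=> phi f alpha n y phihat nu h _ df FF al0 n0 e1 e2 e3.
  exact: deterministic_bound FF al0 n0 e1 e2 e3.
move=> s alpha al0 alcv.
(* This constant depends on a, b, beta, C, M and s alone, and the threshold below on the sequence
   alpha alone, which is the uniformity claimed. The threshold ensures alpha n <= 1 and n >= 1. *)
exists (Rconst beta C + chain_const a b M s * (1 + C * Num.sqrt (b - a))).
move/cvgrPdist_le : alcv => /(_ 1 ltr01)[N0 _ HN].
exists (maxn N0 1) => n; rewrite geq_max => /andP[N0n n0].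
move=> phi f dphi df FF AD d Omega P Y phihat iid res.
apply: (uniform_rate b0 C0 M0 _ n0 dphi df FF AD iid res).
by rewrite al0/=; have := HN n N0n; rewrite /= sub0r normrN gtr0_norm.
Qed.
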